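(* Let $L$ be a finite-dimensional Lie algebra over a field $\mathbb{F}$ of characteristic zero. Then $$\dim_{\mathbb{F}} H^1(L,S)=\dim_{\mathbb{F}}\operatorname{End}_L(S)\cdot[L:S]_{\rm split}$$ holds for every finite-dimensional irreducible $L$-module $S$.
   Context: $H^n(L,M)$ denotes the ordinary (Chevalley–Eilenberg) cohomology of a Lie algebra $L$ with coefficients in an $L$-module $M$. A chief series of a finite-dimensional Lie algebra $L$ is an ascending chain $0=L_0\subset L_1\subset\cdots\subset L_n=L$ of ideals of $L$ such that $L_j/L_{j-1}$ is a minimal (non-zero) ideal of $L/L_{j-1}$ for every $1\le j\le n$; each $L_j/L_{j-1}$ is called a chief factor, and it is an $L$-module via the adjoint action. It is called an abelian chief factor if it is an abelian Lie algebra. For a finite-dimensional irreducible $L$-module $S$ and a given chief series of $L$, $[L:S]_{\rm split}$ denotes the number of indices $j$ such that $L_j/L_{j-1}$ is an abelian chief factor isomorphic to $S$ as an $L$-module and the exact sequence $0\to L_j/L_{j-1}\to L/L_{j-1}\to L/L_j\to 0$ splits in the category of Lie algebras. This number does not depend on the choice of the chief series. *)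

(* Defs.v *)
From HB Require Import structures.
From mathcomp Require Import all_boot all_order all_algebra.
From mathcomp Require Import boolp.

Set Implicit Arguments.
Unset Strict Implicit.
Unset Printing Implicit Defensive.

Import GRing.Theory.
Local Open Scope ring_scope.

HB.mixin Record Vector_isLieAlgebra (F : fieldType) L of Vector F L := {
  lieb : L -> L -> L;
  lieb_linl : forall y, linear (lieb^~ y);
  lieb_linr : forall x, linear (lieb x);
  liebxx : forall x, lieb x x = 0;
  lieb_jacobi : forall x y z,
    lieb x (lieb y z) + lieb y (lieb z x) + lieb z (lieb x y) = 0
}.

#[short(type="lieAlgType")]
HB.structure Definition LieAlgebra (F : fieldType) :=
  {L of Vector_isLieAlgebra F L & Vector F L}.

HB.mixin Record Vector_isLieModule (F : fieldType) (L : lieAlgType F) M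
    of Vector F M := {
  lact : L -> M -> M;
  lact_linl : forall m, linear (lact^~ m);
  lact_linr : forall x, linear (lact x);
  lact_lieb : forall x y m,
    lact (lieb x y) m = lact x (lact y m) - lact y (lact x m)
}.

#[short(type="lieModType")]
HB.structure Definition LieModule (F : fieldType) (L : lieAlgType F) :=
  {M of Vector_isLieModule F L M & Vector F M}.

Arguments lieModType {F} L.

Section LinearFacts.
Variable F : fieldType.

Lemma linfunE (U V : vectType F) (f : U -> V) : linear f -> linfun f =1 f.
Proof.
move=> lf; pose fL : {linear U -> V} :=
  HB.pack f (@GRing.isLinear.Build F U V _ f lf).
exact: (lfunE fL).
Qed.

Lemma lhomP (U V : vectType F) (f : 'Hom(U, V)) a u v :
  f (a *: u + v) = a *: f u + f v.
Proof. exact: linearP. Qed.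

Variable L : lieAlgType F.

Lemma liebD2 (x : L) : {morph lieb x : u v / u + v}.
Proof. by move=> u v; have := lieb_linr x 1 u v; rewrite !scale1r. Qed.

Lemma liebD1 (y : L) : {morph lieb^~ y : u v / u + v}.
Proof. by move=> u v; have /= := lieb_linl y 1 u v; rewrite !scale1r. Qed.

Lemma lieb0 (x : L) : lieb x 0 = 0.
Proof. by apply: (addrI (lieb x 0)); rewrite -liebD2 !addr0. Qed.

Lemma lieb0l (x : L) : lieb 0 x = 0.
Proof. by apply: (addrI (lieb 0 x)); rewrite -liebD1 !addr0. Qed.

Lemma liebC (x y : L) : lieb x y = - lieb y x.
Proof.
apply/eqP; rewrite -addr_eq0; apply/eqP.
have := liebxx (x + y); rewrite liebD1 !liebD2 !liebxx.
by rewrite add0r addr0.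
Qed.

Lemma liebN2 (x y : L) : lieb x (- y) = - lieb x y.
Proof. by apply: (addrI (lieb x y)); rewrite -liebD2 !addrN lieb0. Qed.

Lemma liebN1 (x y : L) : lieb (- x) y = - lieb x y.
Proof. by rewrite liebC liebN2 -liebC. Qed.

Lemma liebZ1 a (x y : L) : lieb (a *: x) y = a *: lieb x y.
Proof. by have /= := lieb_linl y a x 0; rewrite lieb0l !addr0. Qed.

Lemma liebZ2 a (x y : L) : lieb x (a *: y) = a *: lieb x y.
Proof. by have /= := lieb_linr x a y 0; rewrite lieb0 !addr0. Qed.

Variable M : lieModType L.

Lemma lactD2 (x : L) : {morph (@lact F L M x) : u v / u + v}.
Proof. by move=> u v; have := lact_linr x 1 u v; rewrite !scale1r. Qed.

Lemma lactD1 (m : M) : {morph (fun x : L => lact x m) : x y / x + y}.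
Proof. by move=> u v; have /= := lact_linl m 1 u v; rewrite !scale1r. Qed.

Lemma lact0 (x : L) : lact x (0 : M) = 0.
Proof. by apply: (addrI (lact x (0 : M))); rewrite -lactD2 !addr0. Qed.

Lemma lact0l (m : M) : lact (0 : L) m = 0.
Proof. by apply: (addrI (lact (0 : L) m)); rewrite -lactD1 !addr0. Qed.

Lemma lactZ2 a (x : L) (m : M) : lact x (a *: m) = a *: lact x m.
Proof. by have /= := lact_linr x a m 0; rewrite lact0 !addr0. Qed.

Lemma lactZ1 a (x : L) (m : M) : lact (a *: x) m = a *: lact x m.
Proof. by have /= := lact_linl m a x 0; rewrite lact0l !addr0. Qed.

Lemma lactN2 (x : L) (m : M) : lact x (- m) = - lact x m.
Proof. by apply: (addrI (lact x m)); rewrite -lactD2 !addrN lact0. Qed.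

End LinearFacts.

(* Beginning of the Chevalley-Eilenberg complex,
     M --d0--> Hom(L, M) --d1--> Hom(Lambda^2 L, M).
   The last term is embedded in the space of bilinear maps, viewed as
   Hom(L, Hom(L, M)); this does not affect the kernel of d1. *)
Section Cohomology.
Variables (F : fieldType) (L : lieAlgType F) (M : lieModType L).

Definition ce_d0 : 'Hom(M, 'Hom(L, M)) :=
  linfun (fun m : M => linfun (fun x : L => lact x m) : 'Hom(L, M)).

Definition ce_d1 : 'Hom('Hom(L, M), 'Hom(L, 'Hom(L, M))) :=
  linfun (fun f : 'Hom(L, M) =>
    linfun (fun x : L =>
      linfun (fun y : L =>
        lact x (f y) - lact y (f x) - f (lieb x y)) : 'Hom(L, M))
    : 'Hom(L, 'Hom(L, M))).

Lemma ce_d0E m x : ce_d0 m x = lact x m.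
Proof.
have H n : linfun (fun x : L => lact x n : M) =1 fun x => lact x n.
  exact/linfunE/lact_linl.
rewrite /ce_d0 linfunE ?H // => a u v; apply/lfunP => z.
by rewrite add_lfunE scale_lfunE !H lact_linr.
Qed.

Lemma ce_d1E f x y :
  ce_d1 f x y = lact x (f y) - lact y (f x) - f (lieb x y).
Proof.
pose b (g : 'Hom(L, M)) u v : M :=
  lact u (g v) - lact v (g u) - g (lieb u v).
have comb a (p q r p' q' r' : M) : a *: p + p' - (a *: q + q')
    - (a *: r + r') = a *: (p - q - r) + (p' - q' - r').
  by rewrite !scalerBr !opprD [LHS](AC (2*2*2) ((1*3*5)*(2*4*6))).
have b2 g u : linear (b g u).
  by move=> a v w; rewrite /b lieb_linr !lhomP lact_linr
    (lact_linl (g u) a v w) comb.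
have b1 g v a u w : b g (a *: u + w) v = a *: b g u v + b g w v.
  by rewrite /b (lieb_linl v a u w) !lhomP lact_linr
    (lact_linl (g v) a u w) comb.
have b0 a g h u v : b (a *: g + h) u v = a *: b g u v + b h u v.
  by rewrite /b !add_lfunE !scale_lfunE !lact_linr comb.
have E2 g u : linfun (b g u) =1 b g u by apply: linfunE.
have E1 g u : linfun (fun u => linfun (b g u)) u = linfun (b g u).
  apply: linfunE => a v w; apply/lfunP => z.
  by rewrite add_lfunE scale_lfunE !E2 b1.
rewrite /ce_d1 linfunE; last first.
  move=> a g h; apply/lfunP => u; apply/lfunP => v.
  by rewrite !add_lfunE !scale_lfunE !E1 !E2 b0.
by rewrite E1 E2.
Qed.

Definition cocycles1 : {vspace 'Hom(L, M)} := lker ce_d1.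
Definition coboundaries1 : {vspace 'Hom(L, M)} := limg ce_d0.

Lemma coboundaries1_sub : (coboundaries1 <= cocycles1)%VS.
Proof.
apply/subvP => _ /memv_imgP[m _ ->]; rewrite memv_ker.
apply/eqP/lfunP => x; apply/lfunP => y.
by rewrite ce_d1E !ce_d0E lact_lieb subrr !zero_lfunE.
Qed.

Definition dimH1 : nat := (\dim cocycles1 - \dim coboundaries1)%N.

End Cohomology.

Section Modules.
Variables (F : fieldType) (L : lieAlgType F).

Definition irreducible_lmod (M : lieModType L) : Prop :=
  \dim {:M} <> 0%N /\
  forall U : {vspace M},
    (forall (x : L) m, m \in U -> lact x m \in U) ->
    U = 0%VS \/ U = fullv.

Definition lmod_hom (M N : lieModType L) (f : 'Hom(M, N)) : Prop :=
  forall (x : L) m, f (lact x m) = lact x (f m).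

Definition lmod_isog (M N : lieModType L) : Prop :=
  exists f : 'Hom(M, N), lmod_hom f /\ bijective f.

(* End_L(M) is the kernel of f |-> (x |-> (m |-> f (x m) - x (f m))),
   see mem_lmod_end. *)
Definition lmod_end (M : lieModType L) : {vspace 'End(M)} :=
  lker (linfun (fun f : 'End(M) =>
    linfun (fun x : L =>
      linfun (fun m : M => f (lact x m) - lact x (f m)) : 'End(M))
    : 'Hom(L, 'End(M)))).

Lemma mem_lmod_end (M : lieModType L) (f : 'End(M)) :
  f \in lmod_end M <-> lmod_hom f.
Proof.
pose b (g : 'End(M)) (u : L) v : M := g (lact u v) - lact u (g v).
have comb a (p q p' q' : M) : a *: p + p' - (a *: q + q')
    = a *: (p - q) + (p' - q').
  by rewrite !scalerBr !opprD addrACA.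
have b2 g u : linear (b g u).
  by move=> a v w; rewrite /b lact_linr !lhomP lact_linr comb.
have b1 g v a u w : b g (a *: u + w) v = a *: b g u v + b g w v.
  by rewrite /b (lact_linl v a u w) !lhomP (lact_linl (g v) a u w) comb.
have b0 a g h u v : b (a *: g + h) u v = a *: b g u v + b h u v.
  by rewrite /b !add_lfunE !scale_lfunE !lact_linr comb.
have E2 g u : linfun (b g u) =1 b g u by apply: linfunE.
have E1 g u : linfun (fun u => linfun (b g u)) u = linfun (b g u).
  apply: linfunE => a v w; apply/lfunP => z.
  by rewrite add_lfunE scale_lfunE !E2 b1.
rewrite /lmod_end memv_ker linfunE; last first.
  move=> a g h; apply/lfunP => u; apply/lfunP => v.
  by rewrite !add_lfunE !scale_lfunE !E1 !E2 b0.
split=> [/eqP/lfunP fh x m | fh].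
  have /lfunP/(_ m) := fh x; rewrite E1 E2 !zero_lfunE /b => /eqP.
  by rewrite subr_eq0 => /eqP.
apply/eqP/lfunP => x; apply/lfunP => m.
by rewrite E1 E2 !zero_lfunE /b fh subrr.
Qed.

End Modules.

Definition lie_hom (F : fieldType) (L L' : lieAlgType F) (f : 'Hom(L, L')) :
  Prop := forall x y, f (lieb x y) = lieb (f x) (f y).

Record lieIdeal (F : fieldType) (L : lieAlgType F) := LieIdeal {
  lideal_vspace :> {vspace L};
  lidealP : forall x y : L, y \in lideal_vspace -> lieb x y \in lideal_vspace
}.

Definition abelian_lideal (F : fieldType) (L : lieAlgType F)
  (I : lieIdeal L) : Prop :=
  forall x y : L, x \in (I : {vspace L}) -> y \in (I : {vspace L}) ->
  lieb x y = 0.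

Definition minimal_lideal (F : fieldType) (L : lieAlgType F)
  (I : lieIdeal L) : Prop :=
  (I : {vspace L}) <> 0%VS /\
  forall K : lieIdeal L, (K <= I)%VS ->
    (K : {vspace L}) = 0%VS \/ (K : {vspace L}) = I.

(* The quotient L / I, carried by a linear complement of I; lquot I is the
   projection along I.  The bracket is the unique one making lquot I a
   morphism (lquot_lie_hom). *)
Section Quotient.
Variables (F : fieldType) (L : lieAlgType F) (I : lieIdeal L).

Definition lieQuot : Type := subvs_of (I^C)%VS.
HB.instance Definition _ := Vector.on lieQuot.

Definition lquot : 'Hom(L, lieQuot) :=
  linfun (fun x : L => vsproj (I^C)%VS (x - projv I x) : lieQuot).

Lemma lquotE x : lquot x = vsproj (I^C)%VS (x - projv I x).
Proof.
rewrite /lquot linfunE // => a u v.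
by rewrite -linearP; congr (vsproj _ _);
   rewrite linearP scalerBr opprD addrACA.
Qed.

Lemma lquot_valP a (u v : lieQuot) :
  vsval (a *: u + v) = a *: vsval u + vsval v.
Proof. exact: (linearP (@vsval _ _ (I^C)%VS)). Qed.

Lemma vsval_lquot x : vsval (lquot x) = x - projv I x.
Proof. by rewrite lquotE vsprojK ?memv_projC. Qed.

Lemma lquotK (u : lieQuot) : lquot (vsval u) = u.
Proof.
rewrite lquotE; have -> : projv I (vsval u) = 0; last by rewrite subr0 vsvalK.
have : vsval u \in lker (projv I) by rewrite lker_proj subvsP.
by rewrite memv_ker => /eqP.
Qed.

Lemma lker_lquot : lker lquot = I.
Proof.
apply/vspaceP => x; rewrite memv_ker; apply/eqP/idP => [q0|xI].
  have v0 : vsval (0 : lieQuot) = 0 by apply: (linear0 (@vsval _ _ (I^C)%VS)).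
  have := vsval_lquot x; rewrite q0 v0 => /esym/eqP.
  by rewrite subr_eq0 => /eqP ->; apply: memv_proj.
by rewrite lquotE projv_id // subrr linear0.
Qed.

Lemma limg_lquot : limg lquot = fullv.
Proof.
apply/vspaceP => u; rewrite memvf.
by rewrite -(lquotK u) memv_img ?memvf.
Qed.

Lemma lquot_eq x y : lquot x = lquot y <-> x - y \in (I : {vspace L}).
Proof.
rewrite -lker_lquot memv_ker linearB /= subr_eq0.
by split=> [->|/eqP].
Qed.

Definition lquot_br (u v : lieQuot) : lieQuot := lquot (lieb (vsval u) (vsval v)).

Lemma lquot_brE x y : lquot_br (lquot x) (lquot y) = lquot (lieb x y).
Proof.
rewrite /lquot_br !vsval_lquot; apply/lquot_eq.
have -> : lieb (x - projv I x) (y - projv I y) - lieb x y =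
    lieb y (projv I x) - lieb (x - projv I x) (projv I y).
  rewrite liebD2 liebN2 liebD1 liebN1 (liebC y) addrAC.
  by rewrite [_ - _ - lieb x y]addrAC subrr add0r.
by rewrite memvB ?lidealP ?memv_proj.
Qed.

Lemma lquot_ind (P : lieQuot -> Prop) : (forall x, P (lquot x)) -> forall u, P u.
Proof. by move=> H u; rewrite -(lquotK u). Qed.

Lemma lquot_br_linr u : linear (lquot_br u).
Proof.
move: u; apply: lquot_ind => x a.
apply: lquot_ind => y; apply: lquot_ind => z.
by rewrite -lhomP !lquot_brE lieb_linr lhomP.
Qed.

Lemma lquot_br_linl u : linear (lquot_br^~ u).
Proof.
move: u; apply: lquot_ind => x a.
apply: lquot_ind => y; apply: lquot_ind => z.
by rewrite -lhomP !lquot_brE (lieb_linl x a y z) lhomP.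
Qed.

Lemma lquot_brxx u : lquot_br u u = 0.
Proof. by move: u; apply: lquot_ind => x; rewrite lquot_brE liebxx linear0. Qed.

Lemma lquot_br_jacobi u v w :
  lquot_br u (lquot_br v w) + lquot_br v (lquot_br w u)
    + lquot_br w (lquot_br u v) = 0.
Proof.
move: u v w; apply: lquot_ind => x; apply: lquot_ind => y.
apply: lquot_ind => z.
by rewrite !lquot_brE -!linearD /= lieb_jacobi linear0.
Qed.

HB.instance Definition _ := Vector_isLieAlgebra.Build F lieQuot
  lquot_br_linl lquot_br_linr lquot_brxx lquot_br_jacobi.

Lemma lquot_lie_hom : lie_hom lquot.
Proof. by move=> x y; rewrite -lquot_brE. Qed.

(* (I + J) / I, that is, J / I when I <= J. *)
Fact lquot_img_ideal (J : lieIdeal L) (u v : lieQuot) :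
  v \in (lquot @: J)%VS -> lieb u v \in (lquot @: J)%VS.
Proof.
move: u; apply: lquot_ind => x /memv_imgP[y yJ ->].
by rewrite -lquot_lie_hom memv_img // lidealP.
Qed.

Definition lquot_img (J : lieIdeal L) : lieIdeal lieQuot :=
  LieIdeal (@lquot_img_ideal J).

End Quotient.

(* The L-module J / I, under the adjoint action of L. *)
Section Factor.
Variables (F : fieldType) (L : lieAlgType F) (I J : lieIdeal L).

Definition lieFactor : Type := subvs_of (lquot_img I J).
HB.instance Definition _ := Vector.on lieFactor.

Lemma lfactor_valP a (m n : lieFactor) :
  vsval (a *: m + n) = a *: vsval m + vsval n.
Proof. exact: (linearP (@vsval _ _ (lquot_img I J))). Qed.

Lemma lfactor_val_inj (m n : lieFactor) : vsval m = vsval n -> m = n.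
Proof. exact: val_inj. Qed.

Definition lfactor_act (x : L) (m : lieFactor) : lieFactor :=
  vsproj (lquot_img I J) (lieb (lquot I x) (vsval m)).

Lemma vsval_lfactor_act x m :
  vsval (lfactor_act x m) = lieb (lquot I x) (vsval m).
Proof. by rewrite vsprojK // lidealP // subvsP. Qed.

Lemma lfactor_act_linl m : linear (lfactor_act^~ m).
Proof.
move=> a x y; apply: lfactor_val_inj.
by rewrite lfactor_valP !vsval_lfactor_act lhomP
  (lieb_linl (vsval m) a (lquot I x) (lquot I y)).
Qed.

Lemma lfactor_act_linr x : linear (lfactor_act x).
Proof.
move=> a m n; apply: lfactor_val_inj.
by rewrite !(lfactor_valP, vsval_lfactor_act) lieb_linr.
Qed.

Lemma lfactor_act_lieb x y m :
  lfactor_act (lieb x y) m =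
  lfactor_act x (lfactor_act y m) - lfactor_act y (lfactor_act x m).
Proof.
apply: lfactor_val_inj.
rewrite addrC -scaleN1r lfactor_valP scaleN1r addrC.
rewrite !vsval_lfactor_act lquot_lie_hom.
set u := lquot I x; set v := lquot I y; set w := vsval m.
have /eqP := lieb_jacobi u v w.
rewrite addr_eq0 -liebC => /eqP <-.
by rewrite [lieb w u]liebC liebN2.
Qed.

HB.instance Definition _ := Vector_isLieModule.Build F L lieFactor
  lfactor_act_linl lfactor_act_linr lfactor_act_lieb.

(* The canonical map L / I -> L / J, for I <= J. *)
Definition lquot_map : 'Hom(lieQuot I, lieQuot J) :=
  linfun (fun u : lieQuot I => lquot J (vsval u)).

Lemma lquot_mapE : (I <= J)%VS -> forall x, lquot_map (lquot I x) = lquot J x.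
Proof.
move=> /subvP IJ x; rewrite /lquot_map linfunE; last first.
  by move=> a u v; rewrite lquot_valP lhomP.
apply/lquot_eq; rewrite vsval_lquot addrAC subrr add0r memvN.
exact/IJ/memv_proj.
Qed.

(* The exact sequence 0 -> J / I -> L / I -> L / J -> 0 splits. *)
Definition lie_ext_splits : Prop :=
  exists s : 'Hom(lieQuot J, lieQuot I),
    lie_hom s /\ forall u, lquot_map (s u) = u.

End Factor.

Section ChiefSeries.
Variables (F : fieldType) (L : lieAlgType F).

(* The series is (c 0, ..., c n); the values of c beyond n are irrelevant. *)
Definition chief_series (n : nat) (c : nat -> lieIdeal L) : Prop :=
  [/\ (c 0%N : {vspace L}) = 0%VS,
      (c n : {vspace L}) = fullv &
      forall j, (j < n)%N ->
        (c j <= c j.+1)%VS /\ minimal_lideal (lquot_img (c j) (c j.+1))].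

Definition split_factor (S : lieModType L) (I J : lieIdeal L) : Prop :=
  [/\ abelian_lideal (lquot_img I J),
      lmod_isog (lieFactor I J) S &
      lie_ext_splits I J].

Definition split_mult (n : nat) (c : nat -> lieIdeal L) (S : lieModType L) :
  nat := #|[set j : 'I_n | `[< split_factor S (c j) (c j.+1) >]]|.

End ChiefSeries.

(* Main.v *)
Require Import Defs.
From HB Require Import structures.
From mathcomp Require Import all_boot all_order all_algebra.
From mathcomp Require Import all_field ring.
From mathcomp Require Import boolp classical_sets.

Set Implicit Arguments.
Unset Strict Implicit.
Unset Printing Implicit Defensive.

Import GRing.Theory Num.Theory FalgLfun.
Local Open Scope ring_scope.

(** Filter the 1-cocycles of L in S along the chief series: for an ideal I let
    Z(I) be the space of cocycles that vanish on I.  The spaces Z(c j) + B^1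
    decrease from Z^1 to B^1, so dim H^1 is the sum of the dimensions lost when
    passing from I = c j to J = c j.+1, and it is enough to see that each step
    loses dim End_L(S) if J / I is a split factor of type S, and nothing
    otherwise (dim_rel_cocycles_step).

    If J acts trivially on S, then B^1 is contained in Z(J), and the loss is
    the dimension of the space of restrictions to J of the elements of Z(I).
    Such a restriction is an L-homomorphism from J / I to S.  If it is nonzero,
    it is an isomorphism by minimality of J / I and irreducibility of S, and
    the zeros of the cocycle form a subalgebra that complements J / I in L / I;
    conversely a complement gives a projection of L onto J / I, which is a
    cocycle (split_factorP).  So the restrictions form a copy of End_L(S) when
    the factor is split of type S, and vanish when it is not.

    If J does not act trivially, then J / I cannot be an abelian factor of
    type S, and one has to show that Z(I) already consists of coboundaries
    (coboundary_of_vanishing); this is where characteristic zero enters.  A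
    nonzero element of Z(I) forces I to act trivially on S, hence to be the
    kernel of the action of J.  Three cases occur.  When J / I is central in
    L / I, an element of J acts on S as an automorphism of L-modules, which
    trivializes every cocycle.  When the trace form of S is nondegenerate on
    J / I, the Casimir operator does the same.  Otherwise every element of J
    acts as a sum of commutators to which Cartan's criterion applies
    (cartan_nilpotent), hence nilpotently, and Engel's theorem
    (engel) yields a nonzero vector of S killed by J, which contradicts the
    irreducibility of S. *)

(** * Splitting fields and simultaneous congruences of polynomials *)

Lemma exists_irreducible_factor (F : fieldType) (p : {poly F}) :
  (1 < size p)%N -> exists2 q, irreducible_poly q & q %| p.
Proof.
have [n] := ubnP (size p); elim: n p => // n IHn p lt_p_n p_gt1.
have [irr_p | not_irr] := pselect (irreducible_poly p); first by exists p.
have /existsNP[q] : ~ forall q : {poly F}, size q != 1 -> q %| p -> q %= p.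
  by move=> H; apply: not_irr.
move=> /not_implyP[q1 /not_implyP[qp q'p]].
have p0 : p != 0 by rewrite -size_poly_gt0 ltnW.
have lt_qp : (size q < size p)%N.
  by rewrite ltn_neqAle (dvdp_size_eqp qp) dvdp_leq // andbT; apply/negP.
have q_gt1 : (1 < size q)%N.
  by rewrite ltn_neqAle eq_sym q1 size_poly_gt0 (dvdpN0 qp).
have [r irr_r rq] := IHn q (leq_trans lt_qp lt_p_n) q_gt1.
by exists r => //; apply: dvdp_trans qp.
Qed.

Lemma exists_splitting_field (F : fieldType) (p : {poly F}) :
  p != 0 ->
  exists (K : fieldType) (f : {rmorphism F -> K}) (s : seq K),
    map_poly f p %= \prod_(a <- s) ('X - a%:P).
Proof.
have [n] := ubnP (size p); elim: n F p => // n IHn F p lt_p_n p0.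
have [p_le1 | p_gt1] := leqP (size p) 1.
  exists F, idfun, [::]; rewrite big_nil map_poly_id //.
  by rewrite -size_poly_eq1 eqn_leq p_le1 size_poly_gt0.
have [q irr_q qp] := exists_irreducible_factor p_gt1.
have [E _ [z qz0 _]] := irredp_FAdjoin irr_q.
pose g : {rmorphism F -> E} := in_alg E.
have /factor_theorem[p' Dp'] : root (map_poly g p) z.
  move: qp => /(dvdpP _ _)[r ->].
  by rewrite rmorphM rootM qz0 orbT.
have p'0 : p' != 0.
  by apply: contraNneq p0 => p'0; rewrite -(map_poly_eq0 g) Dp' p'0 mul0r.
have sz_p : size p = (size p').+1.
  by rewrite -(size_map_poly g p) Dp' size_Mmonic ?monicXsubC // size_XsubC addn2.
have [|K [f [s Ds]]] := IHn E p' _ p'0; first by rewrite -ltnS -sz_p.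
exists K, (f \o g), (f z :: s).
rewrite map_poly_comp Dp' rmorphM big_cons mulrC /= map_polyXsubC.
by rewrite eqp_mul2l // polyXsubC_eq0.
Qed.

Lemma coprimep_XsubC_exp_prod (K : fieldType) (N : nat) (a : K) (t : seq K) :
  a \notin t -> coprimep (('X - a%:P) ^+ N) (\prod_(b <- t) ('X - b%:P) ^+ N).
Proof.
elim: t => [|b t IHt]; first by rewrite big_nil coprimep1.
rewrite inE negb_or => /andP[ab a't]; rewrite big_cons coprimepMr IHt // andbT.
by rewrite coprimep_expl // coprimep_expr // coprimep_XsubC root_XsubC eq_sym.
Qed.

Lemma dvdp_prod_XsubC_exp (K : fieldType) (N : nat) (t : seq K) (P : {poly K}) :
    uniq t -> (forall a, a \in t -> ('X - a%:P) ^+ N %| P) ->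
  \prod_(a <- t) ('X - a%:P) ^+ N %| P.
Proof.
elim: t => [|b t IHt] /=; first by rewrite big_nil dvd1p.
move=> /andP[b't ut] HP; rewrite big_cons Gauss_dvdp.
  by rewrite HP ?mem_head // IHt // => x xt; rewrite HP // inE xt orbT.
exact: coprimep_XsubC_exp_prod.
Qed.

(** Interpolation to order N: the Chinese remainder theorem for the pairwise
    coprime moduli ('X - a)^N, built one modulus at a time from a Bezout
    relation. *)
Lemma crt_poly (K : fieldType) (N : nat) (s : seq K) (c : K -> K) :
  exists P : {poly K}, forall a, a \in s -> ('X - a%:P) ^+ N %| P - (c a)%:P.
Proof.
elim: s => [|a s [P HP]]; first by exists 0.
have [a_s | a's] := boolP (a \in s).
  by exists P => b; rewrite inE => /predU1P[->|]; apply: HP.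
pose M := \prod_(b <- undup s) ('X - b%:P) ^+ N.
have /Bezout_eq1_coprimepP[[v u] /= uv1] : coprimep (('X - a%:P) ^+ N) M.
  by apply: coprimep_XsubC_exp_prod; rewrite mem_undup.
exists (P + u * M * ((c a)%:P - P)) => b; rewrite inE => /predU1P[-> | bs].
  have -> : P + u * M * ((c a)%:P - P) - (c a)%:P
          = (v * (P - (c a)%:P)) * ('X - a%:P) ^+ N.
    have -> : u * M = 1 - v * ('X - a%:P) ^+ N by rewrite -uv1 addrC addKr.
    by ring.
  exact: dvdp_mull.
rewrite addrAC dvdp_add ?HP // dvdp_mulr // dvdp_mull //.
rewrite /M (bigD1_seq b) ?undup_uniq ?mem_undup //=.
exact: dvdp_mulr.
Qed.

Lemma exists_rat_rmorphism (K : fieldType) :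
  [pchar K] =i pred0 -> inhabited {rmorphism rat -> K}.
Proof.
move=> K0.
have int_neq0 (z : int) : z != 0 -> z%:~R != 0 :> K.
  rewrite -absz_eq0 {2}[z]intEsign => z0.
  by rewrite rmorphMsign /= mulf_neq0 ?signr_eq0 // -pmulrn (iffLR (pcharf0P K)).
have den0 (x : rat) : (denq x)%:~R != 0 :> K by apply/int_neq0/denq_neq0.
have frac (m n : int) : n != 0 -> ratr (m%:Q / n%:Q) = m%:~R / n%:~R :> K.
  move=> n0; apply/eqP; rewrite /ratr eqr_div ?int_neq0 //.
  rewrite -!rmorphM; apply/eqP; congr _%:~R; apply: (@intr_inj rat).
  by rewrite !rmorphM /= numqE mulrAC divfK ?intr_eq0 // mulrC.
have add : zmod_morphism (@ratr K).
  move=> x y; rewrite -{1}(divq_num_den x) -{1}(divq_num_den y).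
  rewrite -mulNr addf_div ?intr_eq0 ?denq_neq0 //.
  rewrite -rmorphN -!rmorphM -rmorphD frac ?mulf_neq0 ?denq_neq0 //.
  by rewrite rmorphD !rmorphM rmorphN /= -addf_div // mulNr.
have mon : monoid_morphism (@ratr K).
  split=> [|x y]; first exact: (ratr_nat K 1).
  rewrite -{1}(divq_num_den x) -{1}(divq_num_den y) mulf_div.
  by rewrite -!rmorphM frac ?mulf_neq0 ?denq_neq0 // !rmorphM /= -mulf_div.
pose iota : {rmorphism rat -> K} := HB.pack (@ratr K)
  (GRing.isZmodMorphism.Build _ _ _ add)
  (GRing.isMonoidMorphism.Build _ _ _ mon).
exact: inhabits iota.
Qed.

(** Cartan's criterion needs to replace the eigenvalues of an operator by
    rational numbers that satisfy the same additive relations, without killing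
    a given nonzero eigenvalue t.  A subspace maximal among those that avoid t
    is a rational hyperplane complementary to t, and Phi is the coordinate
    along t. *)
Lemma exists_rat_linear_functional (K : fieldType) (iota : {rmorphism rat -> K})
    (t : K) : t != 0 ->
  exists Phi : K -> rat, [/\ {morph Phi : x y / x + y},
    (forall x q, Phi (x * iota q) = Phi x * q) & Phi t != 0].
Proof.
move=> t0.
(* M A adds 0 to A: then the empty set, which is the union of the empty chain,
   qualifies too. *)
pose M (A : set K) x := x = 0 \/ A x.
pose P (A : set K) := ~ A t /\
  forall x y q, M A x -> M A y -> M A (x + y * iota q).
have [FF FP Ftot|A [[nAt Acl] Amax]] := @Zorn_bigcup K P.
  split=> [[A FA At]|x y q]; first by case: (FP A FA).
  move=> [->|[A FA Ax]] [->|[B FB By]].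
  - by left; rewrite mul0r addr0.
  - have [] := (FP B FB).2 0 y q; [by left|by right|by left|].
    by right; exists B.
  - by right; exists A => //; rewrite mul0r addr0.
  - have [C FC [Cx Cy]] : exists2 C, FF C & C x /\ C y.
      by case: (Ftot A B FA FB) => sub; [exists B|exists A]; auto.
    have [] := (FP C FC).2 x y q; [by right|by right|by left|].
    by right; exists C.
have dec x : exists q, M A (x - t * iota q).
  have [Mx|nMx] := pselect (M A x); first by exists 0; rewrite rmorph0 mulr0 subr0.
  pose B : set K := [set m + x * iota q | m in M A & q in setT]%classic.
  have MB z : M A z -> B z.
    by move=> Mz; exists z => //; exists 0 => //; rewrite rmorph0 mulr0 addr0.
  have Bt : B t.
    apply: contrapT => nBt; apply: (Amax B).
      split=> [y Ay|]; first by apply: MB; right.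
      move=> BA; apply: nMx; right; apply: BA; exists 0; first by left.
      by exists 1 => //; rewrite rmorph1 mulr1 add0r.
    split=> // y z q.
    have MBE w : M B w -> B w by case=> // ->; apply: MB; left.
    move=> /MBE[m1 Mm1 [q1 _ <-]] /MBE[m2 Mm2 [q2 _ <-]].
    right; exists (m1 + m2 * iota q); first exact: Acl.
    by exists (q1 + q2 * q) => //; rewrite rmorphD rmorphM /=; ring.
  have [m Mm [q _ Dt]] := Bt.
  have q0 : q != 0.
    apply/eqP => q0; move: Dt; rewrite q0 rmorph0 mulr0 addr0 => mt.
    by move: Mm; rewrite mt => -[/eqP|//]; apply/negP.
  exists q^-1; rewrite -Dt mulrDl -mulrA -rmorphM divff // rmorph1 mulr1.
  rewrite opprD addrCA subrr addr0 -mulrN -rmorphN.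
  by rewrite -[_ * _]add0r; apply: Acl => //; left.
have uniq q x : M A (x - t * iota q) -> forall q', M A (x - t * iota q') -> q = q'.
  move=> Mq q' Mq'; apply/eqP/negPn/negP => neq; apply: nAt.
  have q'q : q' - q != 0 by rewrite subr_eq0 eq_sym.
  have [] := Acl 0 ((x - t * iota q) + (x - t * iota q') * iota (-1)) (q' - q)^-1.
  - by left.
  - exact: Acl.
  - rewrite rmorphN rmorph1 add0r (_ : _ + _ = t * iota (q' - q)).
      by rewrite -mulrA -rmorphM divff // rmorph1 mulr1 => /eqP; rewrite (negPf t0).
    by rewrite rmorphB /=; ring.
  - rewrite rmorphN rmorph1 add0r (_ : _ + _ = t * iota (q' - q)).
      by rewrite -mulrA -rmorphM divff // rmorph1 mulr1.
    by rewrite rmorphB /=; ring.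
have [Phi HPhi] := choice dec.
exists Phi; split.
- move=> x y; apply: uniq (HPhi _) _ _; have := Acl _ _ 1 (HPhi x) (HPhi y).
  by rewrite rmorph1 rmorphD mulr1 /=; congr (M A _); ring.
- move=> x q; apply: uniq (HPhi _) _ _.
  have := Acl _ _ q (or_introl _ (erefl 0)) (HPhi x).
  by rewrite rmorphM /= add0r; congr (M A _); ring.
- apply/eqP => Pt; have := HPhi t; rewrite Pt rmorph0 mulr0 subr0 => -[|//].
  exact/eqP.
Qed.

(** * Polynomials in an inner derivation *)

Section AdjointPolynomial.
Variables (K : fieldType) (A : falgType K).
Implicit Types x y v u : A.

(** Inner derivations, as elements of the algebra of endomorphisms of A, so
    that polynomials can be evaluated at them. *)
Definition ad x : 'End(A) := amull x - amulr x.

Lemma adE x v : ad x v = x * v - v * x.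
Proof. by rewrite add_lfunE opp_lfunE !lfunE. Qed.

Lemma amullE u v : amull u v = u * v. Proof. exact: lfunE. Qed.
Lemma amulrE u v : amulr u v = v * u. Proof. exact: lfunE. Qed.

Lemma lfun1E v : (1 : 'End(A)) v = v.
Proof. exact: id_lfunE. Qed.

Lemma lfun_exprS (D : 'End(A)) k v : (D ^+ k.+1) v = D ((D ^+ k) v).
Proof. by rewrite exprSr lfun_mulE. Qed.

(** Left and right multiplications commute, so each term of the binomial
    expansion contains either u1 ^+ N on the left or u2 ^+ N on the right. *)
Lemma sub_amul_nilpotent u1 u2 v N :
    u1 ^+ N * v = 0 -> v * u2 ^+ N = 0 ->
  ((amull u1 - amulr u2) ^+ N.*2) v = 0.
Proof.
move=> u1v vu2; set D := _ - _.
suff H k i j : (N.*2 <= i + j + k)%N -> u1 ^+ i * (D ^+ k) v * u2 ^+ j = 0.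
  by have := H N.*2 0 0 (leqnn _); rewrite expr0 mul1r mulr1.
elim: k i j => [|k IHk] i j.
  rewrite addn0 expr0 lfun1E => le_N.
  have [le_Ni|lt_iN] := leqP N i.
    by rewrite -(subnK le_Ni) exprD -(mulrA _ _ v) u1v mulr0 mul0r.
  have le_Nj : (N <= j)%N.
    by rewrite -(leq_add2l i) (leq_trans _ le_N) // -addnn leq_add2r ltnW.
  by rewrite -(subnKC le_Nj) exprD !mulrA -(mulrA _ v) vu2 mulr0 mul0r.
move=> le_N; rewrite lfun_exprS {1}/D add_lfunE opp_lfunE amullE amulrE mulrBr mulrBl.
rewrite !mulrA -exprSr IHk; last by rewrite addSn addSnnS.
by rewrite -[_ * u2 * _]mulrA -exprS IHk ?subr0 // addnS addSnnS.
Qed.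

Lemma horner_alg_nilpotent (T : 'End(A)) (P : {poly K}) c N v :
    ((T - c%:A) ^+ N) v = 0 -> ('X - c%:P) ^+ N %| P -> horner_alg T P v = 0.
Proof.
move=> Tv /(dvdpP _ _)[Q ->]; rewrite mulrC rmorphM lfun_mulE rmorphXn rmorphB.
by rewrite /= horner_algX horner_algC Tv linear0.
Qed.

End AdjointPolynomial.

Section SpectralDecomposition.
Variables (K : fieldType) (A : falgType K) (x : A) (r : seq K) (N : nat).
Hypotheses (uniq_r : uniq r)
  (x_annul : horner_alg x (\prod_(a <- r) ('X - a%:P) ^+ N) = 0).

Lemma horner_alg_eq0 (P : {poly K}) :
  (forall a, a \in r -> ('X - a%:P) ^+ N %| P) -> horner_alg x P = 0.
Proof.
move=> /(dvdp_prod_XsubC_exp uniq_r) /(dvdpP _ _)[Q ->].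
by rewrite rmorphM /= x_annul mulr0.
Qed.

(** The projections of A onto the generalized eigenspaces of x: e a is the
    value at x of a polynomial congruent to 1 modulo ('X - a)^N and to 0 modulo
    ('X - b)^N for the other b.  A polynomial Q that is constant modulo each
    ('X - a)^N then acts on each of them as a scalar. *)
Lemma spectral_idempotents : exists e : K -> A,
  [/\ \sum_(a <- r) e a = 1,
      forall a, a \in r -> e a * e a = e a,
      forall Q a, horner_alg x Q * e a = e a * horner_alg x Q,
      forall a, a \in r -> (x - a%:A) ^+ N * e a = 0 &
      forall (Q : {poly K}) (c : K -> K),
        (forall a, a \in r -> ('X - a%:P) ^+ N %| Q - (c a)%:P) ->
        forall a, a \in r -> horner_alg x Q * e a = c a *: e a].
Proof.
have [eps Heps] := choice (fun a => crt_poly N r (fun b => (a == b)%:R)).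
pose e a := horner_alg x (eps a).
have killed (P : {poly K}) a : a \in r -> ('X - a%:P) ^+ N %| P ->
    horner_alg x (P * eps a) = 0.
  move=> ar Pa; apply: horner_alg_eq0 => b br; have [<-|ab] := eqVneq a b.
    exact: dvdp_mulr.
  by have := Heps a b br; rewrite (negPf ab) subr0; apply: dvdp_mull.
exists e; split=> [|a ar|Q a|a ar|Q c HQ a ar].
- rewrite /e -rmorph_sum -(rmorph1 (horner_alg x)) /=; apply/eqP.
  rewrite -subr_eq0 -rmorphB; apply/eqP/horner_alg_eq0 => b br.
  rewrite (bigD1_seq b) //= addrAC dvdp_add //.
    by have := Heps b b br; rewrite eqxx.
  rewrite big_seq_cond; elim/big_ind: _ => [|p q|a]; first exact: dvdp0.
    exact: dvdp_add.
  move=> /andP[ar ab]; have := Heps a b br.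
  by rewrite (negPf ab) subr0.
- apply/eqP; rewrite -subr_eq0 -[X in _ - X]mul1r -mulrBl /e.
  by rewrite -(rmorph1 (horner_alg x)) -rmorphB -rmorphM /= killed //;
     have := Heps a a ar; rewrite eqxx.
- by rewrite /e -!rmorphM mulrC.
- have -> : x - a%:A = horner_alg x ('X - a%:P).
    by rewrite rmorphB /= horner_algX horner_algC.
  by rewrite /e -rmorphXn -rmorphM /= killed.
- apply/eqP; rewrite -subr_eq0 -mulr_algl -mulrBl -(horner_algC x (c a)).
  by rewrite -rmorphB /e -rmorphM /= killed ?HQ.
Qed.

(** The operator Q(x), which is phi(a) on the generalized eigenspace of x of
    eigenvalue a, is a replica of x in the sense of Chevalley.  On
    e a * v * e b the derivation ad x is a - b up to a nilpotent operator, so a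
    polynomial that interpolates phi at the differences a - b to a high enough
    order sends ad x to ad (Q(x)); as phi 0 = 0 this polynomial can be taken
    divisible by 'X, which is what the extra factor ad x records. *)
Lemma ad_replica (phi : K -> K) :
    phi 0 = 0 -> (forall a b, phi (a - b) = phi a - phi b) ->
  forall Q : {poly K},
    (forall a, a \in r -> ('X - a%:P) ^+ N %| Q - (phi a)%:P) ->
  exists P : {poly K}, forall v,
    ad (horner_alg x Q) v = horner_alg (ad x) P (ad x v).
Proof.
move=> phi0 phiB Q HQ.
have [e [sum_e _ comm_e nil_e eig_e]] := spectral_idempotents.
pose D := 0 :: [seq a - b | a <- r, b <- r].
(* The order exceeds N.*2 by one so that 'X divides P0 even if N = 0. *)
have [P0 HP0] := crt_poly N.*2.+1 D phi.
have /dvdpP[P DP] : 'X %| P0.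
  have := HP0 0 (mem_head _ _); rewrite phi0 !subr0.
  by apply: dvdp_trans; rewrite exprS dvdp_mulr.
exists P => v.
have -> : horner_alg (ad x) P (ad x v) = horner_alg (ad x) P0 v.
  by rewrite DP mulrC rmorphM lfun_mulE /= horner_algX.
rewrite -[v]mul1r -[1 * v]mulr1 -sum_e mulr_suml mulr_suml.
rewrite !linear_sum; apply: eq_big_seq => a ar /=.
rewrite mulr_sumr !linear_sum; apply: eq_big_seq => b br /=.
rewrite adE !mulrA (eig_e Q phi) // -(mulrA _ (e b)) -comm_e (eig_e Q phi) //.
rewrite -!scalerAr -!scalerAl -scalerBl -phiB.
set w := e a * v * e b.
apply/esym/eqP; rewrite -subr_eq0.
have -> : horner_alg (ad x) P0 w - phi (a - b) *: w =
   horner_alg (ad x) (P0 - (phi (a - b))%:P) w.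
  by rewrite rmorphB /= horner_algC add_lfunE opp_lfunE scale_lfunE lfun1E.
apply/eqP; apply: (horner_alg_nilpotent (c := a - b) (N := N.*2)).
  have -> : ad x - (a - b)%:A = amull (x - a%:A) - amulr (x - b%:A).
    apply/lfunP => u; rewrite /ad !(add_lfunE, opp_lfunE, scale_lfunE, lfun1E).
    rewrite !(amullE, amulrE) mulrBl mulrBr -scalerAl -scalerAr mul1r mulr1.
    by rewrite scalerBl !opprB !addrA [RHS](ACl (1*4*3*2)).
  apply: sub_amul_nilpotent; first by rewrite /w !mulrA nil_e ?mul0r.
  have Dx : x - b%:A = horner_alg x ('X - b%:P).
    by rewrite rmorphB /= horner_algX horner_algC.
  by rewrite /w -mulrA Dx -rmorphXn -comm_e rmorphXn /= -Dx nil_e ?mulr0.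
apply: dvdp_trans (HP0 _ _); first by rewrite dvdp_exp2l.
by rewrite inE; apply/orP; right; apply: allpairs_f.
Qed.

End SpectralDecomposition.

(** * Cartan's nilpotency criterion *)

(** Write u = C *m R with C and R of full rank; a nilpotent u is singular, and
    R *m C is a smaller nilpotent matrix with the same trace. *)
Lemma mxtrace_nilpotent (K : fieldType) n (u : 'M[K]_n) k :
  u ^+ k = 0 -> \tr u = 0.
Proof.
have [m] := ubnP n; elim: m n u k => // m IHm [|n] u k lt_nm uk0.
  by rewrite [u]flatmx0 mxtrace0.
have [r_n|lt_rn] := eqVneq (\rank u) n.+1.
  have uu : u \in unitmx by rewrite -row_free_unit /row_free r_n.
  have uuk j : u ^+ j \in unitmx.
    by elim: j => [|j IHj]; rewrite ?expr0 ?unitmx1 // exprS unitmx_mul uu.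
  by have := uuk k; rewrite uk0 unitr0.
have {}lt_rn : (\rank u < n.+1)%N by rewrite ltn_neqAle lt_rn rank_leq_row.
rewrite -(mulmx_base u) mxtrace_mulC; apply: (IHm _ _ k.+1).
  exact: leq_trans lt_rn _.
have -> j : (row_base u *m col_base u) ^+ j.+1 = row_base u *m u ^+ j *m col_base u.
  elim: j => [|j IHj]; first by rewrite expr1 expr0 mulmx1.
  rewrite exprS IHj exprS.
  transitivity (row_base u *m (col_base u *m row_base u) *m u ^+ j *m col_base u).
    by rewrite -[_ * _]/(_ *m _) !mulmxA.
  by rewrite mulmx_base -[u * _]/(_ *m _) !mulmxA.
by rewrite uk0 mulmx0 mul0mx.
Qed.

(** With e = C *m R of full rank, idempotence says that R *m C is the identity
    matrix of size the rank of e. *)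
Lemma mxtrace_idempotent (K : fieldType) n (e : 'M[K]_n) :
  e *m e = e -> \tr e = (\rank e)%:R.
Proof.
move=> ee; rewrite -{1}(mulmx_base e) mxtrace_mulC.
suff -> : row_base e *m col_base e = 1%:M by rewrite mxtrace1.
have /row_freeP[R] : row_free (row_base e) := row_base_free e.
have /row_fullP[C'] : row_full (col_base e) := col_base_full e.
have := mulmx_base e; move: (row_base e) (col_base e) => B C CB C'C BR.
have : C *m (B *m C) *m B = C *m B by rewrite mulmxA -mulmxA CB ee.
move/(congr1 (fun z => C' *m z *m R)).
by rewrite /= !mulmxA C'C !mul1mx -!mulmxA BR !mulmx1.
Qed.

Lemma horner_alg_mxE (K : fieldType) n (x : 'M[K]_n.+1) (P : {poly K}) :
  horner_alg x P = horner_mx x P.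
Proof.
rewrite /horner_alg /horner_mx /horner_morph; congr (_.[_]).
by apply: eq_map_poly => c; rewrite /= scalemx1.
Qed.

Lemma ad_horner_orthogonal (K : fieldType) n (T : 'End('M[K]_n.+1))
    (u v : 'M[K]_n.+1) (P : {poly K}) :
  (forall k, \tr (u * (T ^+ k.+1) v) = 0) -> \tr (u * horner_alg T P (T v)) = 0.
Proof.
elim/poly_ind: P v => [|P c IHP] v tr0.
  by rewrite rmorph0 lfunE /= mulr0 mxtrace0.
rewrite rmorphD mulrC rmorphM /= horner_algX horner_algC add_lfunE lfun_mulE.
rewrite scale_lfunE lfun1E mulrDr mxtraceD -scalerAr mxtraceZ (tr0 0%N) mulr0.
by rewrite addr0; apply: IHP => k; have := tr0 k.+1; rewrite exprS lfun_mulE.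
Qed.

(** Let y be the replica of x attached to a rational functional Phi.  Since
    ad y is a polynomial without constant term in ad x, the hypothesis on
    traces gives tr (x * y) = 0.  Computed on generalized eigenspaces, this
    trace is the sum of a * Phi(a) * dim; applying Phi once more gives a sum of
    rational squares, so that Phi(a) = 0 for each eigenvalue a.  As Phi was
    arbitrary, every eigenvalue is 0. *)
Lemma cartan_nilpotent_split (K : fieldType) n (x : 'M[K]_n.+1) (r : seq K)
    (s : seq ('M[K]_n.+1 * 'M[K]_n.+1)) :
    [pchar K] =i pred0 -> char_poly x %| \prod_(a <- r) ('X - a%:P) ->
    x = \sum_(p <- s) (p.1 * p.2 - p.2 * p.1) ->
    (forall p k, p \in s -> \tr (p.1 * (ad x ^+ k.+1) p.2) = 0) ->
  exists k, x ^+ k = 0.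
Proof.
move=> K0 splits_x Dx tr0; have [iota] := exists_rat_rmorphism K0.
pose N := size r; pose R := undup r.
have x_annul : horner_alg x (\prod_(a <- R) ('X - a%:P) ^+ N) = 0.
  suff /(dvdp_trans splits_x)/(dvdpP _ _)[q ->] :
      \prod_(a <- r) ('X - a%:P) %| \prod_(a <- R) ('X - a%:P) ^+ N.
    have x0 : horner_alg x (char_poly x) = 0 by rewrite horner_alg_mxE Cayley_Hamilton.
    by rewrite rmorphM /= x0 mulr0.
  rewrite prodrXl /N; have: {subset r <= R} by move=> b; rewrite mem_undup.
  elim: (r) => [|a t IHt] sub; first by rewrite big_nil dvd1p.
  rewrite big_cons exprS dvdp_mul ?IHt //; last first.
    by move=> b bt; rewrite sub // inE bt orbT.
  by rewrite (bigD1_seq a) ?undup_uniq ?sub ?mem_head //= dvdp_mulr.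
have uR : uniq R := undup_uniq r.
have [e [sum_e idem_e comm_e nil_e eig_e]] := spectral_idempotents uR x_annul.
suff e0 a : a \in R -> a != 0 -> e a = 0.
  exists N; rewrite -[LHS]mulr1 -sum_e mulr_sumr big1_seq // => a /= aR.
  have [a0|/(e0 a aR) ->] := eqVneq a 0; last by rewrite mulr0.
  by have := nil_e a aR; rewrite a0 scale0r subr0.
move=> aR a0; have [Phi [PhiD PhiZ Phi_a]] := exists_rat_linear_functional iota a0.
pose phi t := iota (Phi t).
have Phi0 : Phi 0 = 0 by apply: (addrI (Phi 0)); rewrite -PhiD !addr0.
have PhiB t1 t2 : Phi (t1 - t2) = Phi t1 - Phi t2.
  by apply: (addIr (Phi t2)); rewrite -PhiD !subrK.
have [Q HQ] := crt_poly N R phi.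
have [||P HP] := ad_replica uR x_annul (phi := phi) _ _ HQ.
- by rewrite /phi Phi0 rmorph0.
- by move=> t1 t2; rewrite /phi PhiB rmorphB.
set y := horner_alg x Q in HP.
have tr_xy : \tr (x * y) = 0.
  rewrite {1}Dx mulr_suml raddf_sum big1_seq //= => p /= ps.
  have -> : \tr ((p.1 * p.2 - p.2 * p.1) * y) = - \tr (p.1 * ad y p.2).
    rewrite adE mulrBr mulrBl !linearB /= opprB !mulrA; congr (_ - _).
    by rewrite -[p.2 * _ * y]mulrA; exact: mxtrace_mulC.
  by rewrite HP ad_horner_orthogonal ?oppr0 // => k; apply: tr0.
have tr_xe b : b \in R -> \tr (x * e b) = b * (\rank (e b))%:R.
  move=> bR; rewrite -{1}(subrK (b%:A) x) mulrDl mxtraceD mulr_algl mxtraceZ.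
  rewrite (mxtrace_idempotent (idem_e b bR)) (mxtrace_nilpotent (k := N.+1)) ?add0r //.
  have xbe : GRing.comm (x - b%:A) (e b).
    have := comm_e ('X - b%:P) b.
    by rewrite rmorphB /= horner_algX horner_algC.
  rewrite exprMn_comm // [e b ^+ _]exprS exprS mulrA -[_ * e b]mulrA.
  by rewrite nil_e ?mulr0 ?mul0r.
have : \sum_(b <- R) b * iota (Phi b * (\rank (e b))%:R) = 0.
  rewrite -[RHS]tr_xy -[y]mulr1 -sum_e !mulr_sumr raddf_sum.
  apply: eq_big_seq => b bR /=; rewrite (eig_e Q phi) // -scalerAr mxtraceZ.
  by rewrite tr_xe // rmorphM rmorph_nat mulrCA mulrA.
move/(congr1 Phi); rewrite Phi0.
rewrite (big_morph Phi PhiD Phi0).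
under eq_bigr do rewrite PhiZ mulrA -expr2.
move/eqP; rewrite psumr_eq0 => [/allP/(_ a aR)|b _]; last first.
  by rewrite mulr_ge0 ?sqr_ge0 ?ler0n.
by rewrite mulf_eq0 sqrf_eq0 (negPf Phi_a) /= pnatr_eq0 mxrank_eq0 => /eqP.
Qed.

(** The hypothesis on traces involves only iterates of ad x, so that it
    survives the extension of scalars to a splitting field of the
    characteristic polynomial of x. *)
Lemma cartan_nilpotent (F : fieldType) n (x : 'M[F]_n)
    (s : seq ('M[F]_n * 'M[F]_n)) :
    [pchar F] =i pred0 ->
    x = \sum_(p <- s) (p.1 *m p.2 - p.2 *m p.1) ->
    (forall p k, p \in s ->
      \tr (p.1 *m iter k.+1 (fun w => x *m w - w *m x) p.2) = 0) ->
  exists k, x ^+ k = 0.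
Proof.
case: n x s => [|n] x s F0 Dx tr0; first by exists 0; apply: flatmx0.
have char0 : char_poly x != 0 by rewrite monic_neq0 ?char_poly_monic.
have [K [f [r splits_x]]] := exists_splitting_field char0.
have K0 : [pchar K] =i pred0 by move=> p; rewrite (fmorph_pchar f).
have [||p k|k xk0] := @cartan_nilpotent_split K n (map_mx f x) r
    [seq (map_mx f p.1, map_mx f p.2) | p <- s] K0.
- by rewrite -map_char_poly (eqp_dvdl _ splits_x) dvdpp.
- rewrite {1}Dx raddf_sum big_map /=; apply: eq_bigr => p _.
  by rewrite raddfB /= !map_mxM.
- move=> /mapP[{}p ps -> /=]; have := tr0 p k ps.
  move/(congr1 f); rewrite rmorph0 -trace_map_mx map_mxM => <-.
  congr (\tr (_ *m _)); elim: k.+1 => [|j IHj]; first by rewrite lfun1E.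
  by rewrite lfun_exprS IHj adE /= raddfB /= !map_mxM.
- exists k; apply: (@map_mx_inj _ _ f); rewrite raddf0 -xk0.
  by rewrite -rmorphXn.
Qed.

(** * The adjoint module and Engel's theorem *)

Section Adjoint.
Variables (F : fieldType) (L : lieAlgType F).

Definition lieAdjoint : Type := L.
HB.instance Definition _ := Vector.on lieAdjoint.

Lemma lieb_leibniz (x y z : L) :
  lieb (lieb x y) z = lieb x (lieb y z) - lieb y (lieb x z).
Proof.
have /eqP := lieb_jacobi x y z.
by rewrite (liebC z x) (liebC z) liebN2 subr_eq0 => /eqP.
Qed.

HB.instance Definition _ := Vector_isLieModule.Build F L lieAdjoint
  (@lieb_linl F L) (@lieb_linr F L) lieb_leibniz.

End Adjoint.

Section Engel.
Variables (F : fieldType) (L : lieAlgType F) (I J : {vspace L}).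

Definition subalgebra (K : {vspace L}) :=
  forall x y, x \in K -> y \in K -> lieb x y \in K.

Definition stable (K : {vspace L}) (M : lieModType L) (V : {vspace M}) :=
  forall (x : L) m, x \in K -> m \in V -> lact x m \in V.

(** Engel's theorem for K, in a form relative to a pair W <= V of K-modules:
    this avoids quotient modules, and the pair K <= J of adjoint modules is
    itself an instance.  Elements of I play the role of elements that act
    by zero on V / W. *)
Definition engel_holds (K : {vspace L}) := forall (M : lieModType L) (W V : {vspace M}),
  (W <= V)%VS -> W != V -> stable K V -> stable K W ->
  (forall (x : L) m, x \in I -> m \in V -> lact x m \in W) ->
  (forall (x : L) m, x \in K -> m \in V -> exists k, iter k (lact x) m \in W) ->
  exists m, [/\ m \in V, m \notin W & forall x : L, x \in K -> lact x m \in W].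

Lemma engel_bottom : engel_holds I.
Proof.
move=> M W V WV neqWV stV stW IV _.
have /subvPn[m mV m'W] : ~~ (V <= W)%VS.
  by apply: contraNN neqWV => VW; rewrite eqEsubv WV.
by exists m; split=> // x xI; apply: IV.
Qed.

(** If K kills m modulo W, so does each iterate of x on m, because x
    normalizes K; the last iterate that is not in W is killed by x as well. *)
Lemma engel_step (K : {vspace L}) (x : L) :
    (forall z, z \in K -> lieb z x \in K) ->
  engel_holds K -> engel_holds (K + <[x]>)%VS.
Proof.
move=> Kx eK M W V WV neqWV stV stW IV nilp.
have K_Kx z : z \in K -> z \in (K + <[x]>)%VS by apply/subvP/addvSl.
have x_Kx : x \in (K + <[x]>)%VS by apply: (subvP (addvSr _ _)); apply: memv_line.
have [|||m [mV m'W mK]] := eK M W V WV neqWV _ _ IV.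
- by move=> z m /K_Kx; apply: stV.
- by move=> z m /K_Kx; apply: stW.
- by move=> z m /K_Kx; apply: nilp.
have good k : iter k (lact x) m \in V /\
    forall z, z \in K -> lact z (iter k (lact x) m) \in W.
  elim: k => [|k [IHV IHW]] //=; split=> [|z zK]; first exact: stV.
  have -> : lact z (lact x (iter k (lact x) m)) =
     lact (lieb z x) (iter k (lact x) m) + lact x (lact z (iter k (lact x) m)).
    by rewrite lact_lieb subrK.
  by rewrite memvD ?IHW ?Kx //; apply: stW => //; apply: IHW.
have /ex_minnP[[//|k] xkW kmin] := nilp x m x_Kx mV.
  by rewrite xkW in m'W.
exists (iter k (lact x) m); split=> [||z /memv_addP[u uK [_ /vlineP[a ->] ->]]].
- exact: (good k).1.
- by apply/negP => /kmin; rewrite ltnn.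
- by rewrite lactD1 lactZ1 memvD ?memvZ // (good k).2.
Qed.

Hypotheses (IJ : (I <= J)%VS)
  (JI : forall x y, x \in J -> y \in I -> lieb x y \in I)
  (subJ : subalgebra J)
  (ad_nilp : forall x y, x \in J -> y \in J -> exists k, iter k (lieb x) y \in I).

(** Starting from I, enlarge a subalgebra K for which Engel's theorem is known:
    applied to the adjoint action of K on J modulo K, the theorem itself
    provides the element of J that normalizes K needed in engel_step. *)
Lemma engel : engel_holds J.
Proof.
suff H n (K : {vspace L}) : (\dim J - \dim K <= n)%N -> (I <= K)%VS -> (K <= J)%VS ->
    subalgebra K -> engel_holds K -> engel_holds J.
  apply: (H _ I (leqnn _)) => //; last exact: engel_bottom.
  by move=> x y /(subvP IJ); apply: JI.
elim: n K => [|n IHn] K le_n IK KJ subK eK.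
  suff <- : K = J by [].
  by apply/eqP; rewrite eqEdim KJ -subn_eq0 -leqn0.
have [<- //|neqKJ] := eqVneq K J.
have [||||x [xJ x'K Kx]] := eK (lieAdjoint L) K J KJ neqKJ.
- by move=> x y /(subvP KJ) xJ yJ; apply: subJ.
- exact: subK.
- move=> x y xI yJ; apply: (subvP IK); rewrite -[lact x y]/(lieb x y) liebC memvN.
  exact: JI.
- move=> x y /(subvP KJ) xJ yJ; have [k Hk] := ad_nilp xJ yJ.
  by exists k; apply: (subvP IK).
have KxK : (K <= K + <[x]>)%VS by apply: addvSl.
have xKx : x \in (K + <[x]>)%VS by apply: (subvP (addvSr _ _)); apply: memv_line.
have ltK : (\dim K < \dim (K + <[x]>))%N.
  rewrite ltn_neqAle dimvS // andbT; apply: contraNneq x'K => eqd.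
  by have /eqP -> : K == (K + <[x]>)%VS by rewrite eqEdim KxK eqd leqnn.
have KxJ : (K + <[x]> <= J)%VS by rewrite subv_add KJ -memvE.
apply: (IHn (K + <[x]>)%VS) => //.
- rewrite leq_subLR (leq_trans _ (leq_add ltK (leqnn n))) //.
  by rewrite addSnnS -leq_subLR.
- exact: subv_trans IK KxK.
- move=> _ _ /memv_addP[u uK [_ /vlineP[a ->] ->]] /memv_addP[v vK [_ /vlineP[b ->] ->]].
  apply: (subvP KxK); rewrite liebD1 !liebD2 !liebZ1 !liebZ2 liebxx.
  rewrite !scaler0 addr0 !memvD ?memvZ //; [exact: subK|exact: Kx|].
  by rewrite liebC memvN; apply: Kx.
- exact: engel_step Kx eK.
Qed.

End Engel.

(** * Irreducible modules and the trace form *)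

(** Closed predicates are how submodules, ideals and radicals are given below;
    the subspace is one of maximal dimension contained in P. *)
Lemma vspace_of_pred (F : fieldType) (V : vectType F) (P : V -> Prop) :
    P 0 -> (forall a u v, P u -> P v -> P (a *: u + v)) ->
  exists U : {vspace V}, forall v, v \in U <-> P v.
Proof.
move=> P0 Plin.
pose Q d := `[< exists U : {vspace V}, \dim U = d /\ forall v, v \in U -> P v >].
have Q0 : exists d, Q d.
  exists 0%N; apply/asboolP; exists 0%VS; rewrite dimv0; split=> // v.
  by rewrite memv0 => /eqP ->.
have Qbound d : Q d -> (d <= \dim {:V})%N.
  by move=> /asboolP[U [<- _]]; apply: dimvS; apply: subvf.
have [_ /asboolP[U [<- UP]] Umax] := ex_maxnP Q0 Qbound.
exists U => v; split=> [/UP //|Pv]; apply/negPn/negP => v'U.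
have /Umax : Q (\dim (U + <[v]>)).
  apply/asboolP; exists (U + <[v]>)%VS; split=> // w.
  by move=> /memv_addP[u /UP Pu [_ /vlineP[a ->] ->]]; rewrite addrC; apply: Plin.
apply/negP; rewrite -ltnNge ltn_neqAle dimvS ?addvSl // andbT.
apply: contraNneq v'U => eqd.
have /eqP -> : U == (U + <[v]>)%VS by rewrite eqEdim addvSl eqd leqnn.
by apply: (subvP (addvSr _ _)); apply: memv_line.
Qed.

Section IrreducibleModules.
Variables (F : fieldType) (L : lieAlgType F) (S : lieModType L).

Lemma lact_suml (I : Type) (r : seq I) (P : pred I) (f : I -> L) (m : S) :
  lact (\sum_(i <- r | P i) f i) m = \sum_(i <- r | P i) lact (f i) m.
Proof. exact: (big_morph _ (lactD1 m) (lact0l m)). Qed.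

Lemma lact_sumr (I : Type) (r : seq I) (P : pred I) x (f : I -> S) :
  lact x (\sum_(i <- r | P i) f i) = \sum_(i <- r | P i) lact x (f i).
Proof. exact: (big_morph _ (@lactD2 _ _ _ x) (lact0 _ x)). Qed.

Lemma lactN1 x (m : S) : lact (- x) m = - lact x m.
Proof. by apply: (addrI (lact x m)); rewrite -lactD1 !addrN lact0l. Qed.

Lemma cocycles1P (f : 'Hom(L, S)) : reflect
  (forall x y, f (lieb x y) = lact x (f y) - lact y (f x)) (f \in cocycles1 S).
Proof.
rewrite memv_ker; apply: (iffP eqP) => [f0 x y | Hf].
  by have := ce_d1E f x y; rewrite f0 !zero_lfunE => /esym/eqP; rewrite subr_eq0 => /eqP.
by apply/lfunP => x; apply/lfunP => y; rewrite ce_d1E Hf subrr !zero_lfunE.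
Qed.

Lemma coboundaries1P (f : 'Hom(L, S)) :
  (exists m, forall x, f x = lact x m) <-> f \in coboundaries1 S.
Proof.
split=> [[m Hm]|/memv_imgP[m _ ->]]; last by exists m => x; rewrite ce_d0E.
by apply/memv_imgP; exists m; rewrite ?memvf //; apply/lfunP => x; rewrite ce_d0E.
Qed.

Definition acts_trivially (K : {vspace L}) :=
  forall x (m : S), x \in K -> lact x m = 0.

Hypothesis irrS : irreducible_lmod S.

Lemma irreducible_pred (P : S -> Prop) :
    P 0 -> (forall a u v, P u -> P v -> P (a *: u + v)) ->
    (forall (x : L) m, P m -> P (lact x m)) ->
  (exists2 m, m != 0 & P m) -> forall m, P m.
Proof.
move=> P0 Plin PL [m m0 Pm]; have [U UP] := vspace_of_pred P0 Plin.
have [|U0|UT] := irrS.2 U.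
- by move=> x u /UP Pu; apply/UP/PL.
- by move/UP: Pm; rewrite U0 memv0 (negPf m0).
- by move=> u; apply/UP; rewrite UT memvf.
Qed.

Lemma schur_injective (h : 'End(S)) :
  lmod_hom h -> h != 0 -> lker h == 0%VS.
Proof.
move=> hL h0; rewrite -subv0; apply/subvP => m; rewrite memv_ker memv0.
apply: contraTT => m0; apply: contraNN h0 => /eqP hm0.
have H : forall u, h u = 0.
  apply: irreducible_pred; last by exists m.
  - exact: linear0.
  - by move=> a u v hu hv; rewrite lhomP hu hv scaler0 addr0.
  - by move=> x u hu; rewrite hL hu lact0.
by apply/eqP/lfunP => u; rewrite H zero_lfunE.
Qed.

(** An endomorphism h as in Schur's lemma is invertible, and h^-1 m is a
    primitive of f. *)
Lemma coboundary_of_schur (h : 'End(S)) (f : 'Hom(L, S)) (m : S) :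
    lmod_hom h -> h != 0 -> (forall x, h (f x) = lact x m) ->
  f \in coboundaries1 S.
Proof.
move=> hL h0 Hf; have ker0 := schur_injective hL h0.
have /lker0P hinj := ker0.
apply/coboundaries1P; exists (h^-1%VF m) => x; apply: hinj.
by rewrite Hf hL lker0_lfunVK.
Qed.

End IrreducibleModules.

Section Representation.
Variables (F : fieldType) (L : lieAlgType F) (S : lieModType L).
Local Notation d := (\dim {:S}).
Local Notation b := (vbasis {:S}).

(** Coordinates of S are written as columns so that rep, defined next, is a
    homomorphism and not an antihomomorphism of Lie algebras. *)
Definition colv (m : S) : 'cV[F]_d := \col_i coord b i m.
Definition rep (x : L) : 'M[F]_d := \matrix_(i, j) coord b i (lact x b`_j).

Lemma rep_colv x m : rep x *m colv m = colv (lact x m).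
Proof.
apply/matrixP => i j; rewrite !mxE [in RHS](coord_vbasis (memvf m)).
rewrite lact_sumr linear_sum; apply: eq_bigr => k _.
by rewrite !mxE lactZ2 linearZ mulrC.
Qed.

Lemma colv_inj : injective colv.
Proof.
move=> u v /matrixP uv; rewrite (coord_vbasis (memvf u)) (coord_vbasis (memvf v)).
by apply: eq_bigr => i _; have := uv i 0; rewrite !mxE => ->.
Qed.

Lemma colv_eq0 m : colv m = 0 -> m = 0.
Proof.
by move=> m0; apply: colv_inj; rewrite m0; apply/matrixP => i j; rewrite !mxE linear0.
Qed.

Lemma colv_eq (A B : 'M[F]_d) : (forall m, A *m colv m = B *m colv m) -> A = B.
Proof.
move=> AB; apply/matrixP => i j.
have := AB b`_j; have -> : colv b`_j = delta_mx j 0.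
  apply/matrixP => k l; rewrite !mxE coord_free ?(basis_free (vbasisP _)) //.
  by rewrite ord1 eqxx andbT eq_sym.
by rewrite -!colE => /matrixP/(_ i 0); rewrite !mxE.
Qed.

Lemma colv_linear a u v : colv (a *: u + v) = a *: colv u + colv v.
Proof. by apply/matrixP => i j; rewrite !mxE linearP. Qed.

Lemma rep_linear a x y : rep (a *: x + y) = a *: rep x + rep y.
Proof. by apply/matrixP => i j; rewrite !mxE lactD1 lactZ1 linearP. Qed.

HB.instance Definition _ := GRing.isLinear.Build F L 'M[F]_d _ rep rep_linear.
HB.instance Definition _ := GRing.isLinear.Build F S 'cV[F]_d _ colv colv_linear.

Lemma rep_lieb x y : rep (lieb x y) = rep x *m rep y - rep y *m rep x.
Proof.
apply: colv_eq => m.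
by rewrite mulmxBl -!mulmxA !rep_colv -linearB lact_lieb.
Qed.

Lemma rep_eq0 x : rep x = 0 <-> forall m, lact x m = 0 :> S.
Proof.
split=> [x0 m|x0]; first by apply: colv_eq0; rewrite -rep_colv x0 mul0mx.
by apply: colv_eq => m; rewrite rep_colv x0 mul0mx linear0.
Qed.

Lemma rep_exp x k m : rep x ^+ k *m colv m = colv (iter k (lact x) m).
Proof.
elim: k => [|k IHk]; first by rewrite expr0 mul1mx.
by rewrite exprS /= -mulmxA IHk rep_colv.
Qed.

Lemma rep_iter_lieb x y k : rep (iter k (lieb x) y) =
  iter k (fun w => rep x *m w - w *m rep x) (rep y).
Proof. by elim: k => //= k <-; rewrite rep_lieb. Qed.

Definition trform x y : F := \tr (rep x *m rep y).

Lemma trformC x y : trform x y = trform y x.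
Proof. exact: mxtrace_mulC. Qed.

Lemma trformB x y z : trform x (y - z) = trform x y - trform x z.
Proof. by rewrite /trform linearB mulmxBr linearB. Qed.

Lemma trform_sumr (I : Type) (r : seq I) (c : I -> F) (e : I -> L) x :
  trform x (\sum_(i <- r) c i *: e i) = \sum_(i <- r) c i * trform x (e i).
Proof.
rewrite /trform linear_sum mulmx_sumr linear_sum; apply: eq_bigr => i _.
by rewrite linearZ /= -scalemxAr mxtraceZ.
Qed.

Lemma trform_lieb x y z : trform (lieb x y) z = - trform y (lieb x z).
Proof.
rewrite /trform !rep_lieb mulmxBl mulmxBr !linearB /= opprB !mulmxA; congr (_ - _).
by rewrite -[X in \tr X = _]mulmxA mxtrace_mulC.
Qed.

End Representation.

Lemma iter_commutator_nilpotent (F : fieldType) n (x v : 'M[F]_n) k :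
  x ^+ k = 0 -> exists j, iter j (fun w => x *m w - w *m x) v = 0.
Proof.
case: n x v => [|n] x v xk0; first by exists 0; apply: flatmx0.
exists k.*2; have <- : (ad x ^+ k.*2) v = 0.
  by apply: sub_amul_nilpotent; rewrite xk0 ?mulr0 ?mul0r.
by elim: {xk0}k.*2 => [|j IHj]; rewrite ?lfun1E // lfun_exprS -IHj adE.
Qed.

(** * Cocycles vanishing below a factor that acts nontrivially *)

Section ChiefFactor.
Variables (F : fieldType) (L : lieAlgType F) (I J : lieIdeal L).
Hypotheses (IJ : (I <= J)%VS) (minIJ : minimal_lideal (lquot_img I J)).

(** The minimality of J / I, transported from ideals of L / I to predicates on
    L. *)
Lemma chief_factor_dichotomy (P : L -> Prop) :
    P 0 -> (forall a x y, P x -> P y -> P (a *: x + y)) ->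
    (forall x y, P y -> P (lieb x y)) ->
    (forall x, x \in (I : {vspace L}) -> P x) ->
    (forall x, P x -> x \in (J : {vspace L})) ->
  (forall x, P x -> x \in (I : {vspace L})) \/
  (forall x, x \in (J : {vspace L}) -> P x).
Proof.
move=> P0 Plin Pid IP PJ; have [U UP] := vspace_of_pred P0 Plin.
have Uid x y : y \in U -> lieb x y \in U by move=> /UP Py; apply/UP/Pid.
pose K := LieIdeal Uid.
have [|K0|KJ] := minIJ.2 (lquot_img I K).
- by apply: limgS; apply/subvP => x /UP /PJ.
- left=> x /UP xU; have : lquot I x \in lquot_img I K by apply: memv_img.
  by rewrite K0 memv0 -memv_ker lker_lquot.
- right=> x xJ; have : lquot I x \in (lquot_img I J : {vspace _}) by apply: memv_img.
  rewrite -KJ => /memv_imgP[y /UP Py /lquot_eq /IP Pxy].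
  by have := Plin 1 _ _ Pxy Py; rewrite scale1r subrK.
Qed.

Lemma chief_factor_proper : ~ (J <= I)%VS.
Proof.
move=> JI; apply: minIJ.1; apply/eqP; rewrite -subv0.
apply/subvP => _ /memv_imgP[x xJ ->].
by rewrite memv0 -memv_ker lker_lquot; apply: (subvP JI).
Qed.

Section Brackets.
Variable A : lieIdeal L.

(** The ideal [A, J] + I, with elements given as explicit sums of brackets
    because cartan_nilpotent takes such sums as input. *)
Definition bracket_sum (x : L) := exists s : seq (L * L),
  (forall p, p \in s -> p.1 \in (A : {vspace L}) /\ p.2 \in (J : {vspace L})) /\
  x - \sum_(p <- s) lieb p.1 p.2 \in (I : {vspace L}).

Lemma bracket_sum_dichotomy :
  (forall x y, x \in (A : {vspace L}) -> y \in (J : {vspace L}) ->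
     lieb x y \in (I : {vspace L})) \/
  (forall x, x \in (J : {vspace L}) -> bracket_sum x).
Proof.
have [||||| sub | all] := chief_factor_dichotomy (P := bracket_sum).
- by exists [::]; split=> //; rewrite big_nil subr0 mem0v.
- move=> a x y [s [sAJ sx]] [t [tAJ ty]].
  exists ([seq (a *: p.1, p.2) | p <- s] ++ t); split=> [p|].
    rewrite mem_cat => /orP[/mapP[{}p /sAJ[pA pJ] ->]|/tAJ //].
    by split=> //; apply: memvZ.
  rewrite big_cat big_map /=.
  have -> : \sum_(p <- s) lieb (a *: p.1) p.2 = a *: \sum_(p <- s) lieb p.1 p.2.
    by rewrite scaler_sumr; apply: eq_bigr => p _; rewrite liebZ1.
  by rewrite opprD addrACA -scalerBr memvD ?memvZ.
- move=> x y [s [sAJ sy]].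
  exists ([seq (lieb x p.1, p.2) | p <- s] ++ [seq (p.1, lieb x p.2) | p <- s]).
  split=> [p|].
    rewrite mem_cat => /orP[] /mapP[{}p /sAJ[pA pJ] ->]; split=> //=; exact: lidealP.
  rewrite big_cat /= !big_map /= -big_split /=.
  have -> : \sum_(p <- s) (lieb (lieb x p.1) p.2 + lieb p.1 (lieb x p.2))
          = lieb x (\sum_(p <- s) lieb p.1 p.2).
    rewrite (big_morph _ (@liebD2 _ _ x) (lieb0 x)); apply: eq_bigr => p _.
    by rewrite lieb_leibniz subrK.
  by rewrite -liebN2 -liebD2 lidealP.
- by move=> x xI; exists [::]; split=> //; rewrite big_nil subr0.
- move=> x [s [sAJ sx]]; rewrite -(subrK (\sum_(p <- s) lieb p.1 p.2) x).
  rewrite memvD ?(subvP IJ _ sx) // big_seq memv_suml // => p /sAJ[_ pJ].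
  exact: lidealP.
- left=> x y xA yJ; apply: sub; exists [:: (x, y)]; split=> [p|].
    by rewrite inE => /eqP ->.
  by rewrite big_seq1 subrr mem0v.
- by right.
Qed.

End Brackets.

Variables (S : lieModType L).
Hypotheses (charF0 : [pchar F] =i pred0) (irrS : irreducible_lmod S).
Hypotheses (I_triv : acts_trivially S I) (J_nontriv : ~ acts_trivially S J).

(** The kernel of the action of J on S is an ideal between I and J, and it is
    not J. *)
Lemma triv_mem x : x \in (J : {vspace L}) -> (forall m : S, lact x m = 0) ->
  x \in (I : {vspace L}).
Proof.
have [||||| sub | all] := chief_factor_dichotomy
  (P := fun x => x \in (J : {vspace L}) /\ forall m : S, lact x m = 0).
- by split=> [|m]; rewrite ?mem0v ?lact0l.
- move=> a y z [yJ y0] [zJ z0]; split=> [|m]; first by rewrite memvD ?memvZ.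
  by rewrite lactD1 lactZ1 y0 z0 scaler0 addr0.
- move=> y z [zJ z0]; split=> [|m]; first exact: lidealP.
  by rewrite lact_lieb !z0 lact0 subrr.
- by move=> y yI; split=> [|m]; [apply: (subvP IJ) | apply: I_triv].
- by move=> y [].
- by move=> xJ x0; apply: sub.
- by case: J_nontriv => y m /all[].
Qed.

(** By Engel's theorem a nilpotent action of J would kill a nonzero vector;
    the vectors killed by J form a submodule, which would be all of S. *)
Lemma not_all_nilpotent :
  ~ forall x, x \in (J : {vspace L}) -> exists k, rep S x ^+ k = 0.
Proof.
move=> nilp; have JI x y : x \in (J : {vspace L}) -> y \in (I : {vspace L}) ->
    lieb x y \in (I : {vspace L}) by move=> _; apply: lidealP.
have subJ : subalgebra J by move=> x y _; apply: lidealP.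
have ad_nilp x y : x \in (J : {vspace L}) -> y \in (J : {vspace L}) ->
    exists k, iter k (lieb x) y \in (I : {vspace L}).
  move=> /nilp[k xk0] yJ; have [j Hj] := iter_commutator_nilpotent (rep S y) xk0.
  exists j; apply: triv_mem; first by elim: j {Hj} => //= j; apply: lidealP.
  by apply/rep_eq0; rewrite rep_iter_lieb.
have [||||||m [_ m0 mJ]] := engel IJ JI subJ ad_nilp (M := S) (W := 0%VS) (V := fullv).
- exact: sub0v.
- by rewrite eq_sym -dimv_eq0; apply/eqP; exact: irrS.1.
- by move=> x m _ _; apply: memvf.
- by move=> x m _; rewrite !memv0 => /eqP ->; rewrite lact0.
- by move=> x m xI _; rewrite memv0 I_triv.
- move=> x m /nilp[k xk0] _; exists k; rewrite memv0; apply/eqP/colv_eq0.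
  by rewrite -rep_exp xk0 mul0mx.
rewrite memv0 in m0; apply: J_nontriv => x u xJ.
suff H : forall u : S, forall x, x \in (J : {vspace L}) -> lact x u = 0 by apply: H.
apply: (irreducible_pred irrS); last by exists m => // y /mJ; rewrite memv0 => /eqP.
- by move=> y _; rewrite lact0.
- by move=> a v w v0 w0 y yJ; rewrite lactD2 lactZ2 v0 // w0 // scaler0 addr0.
- move=> z v v0 y yJ.
  have -> : lact y (lact z v) = lact (lieb y z) v + lact z (lact y v).
    by rewrite lact_lieb subrK.
  by rewrite v0 ?v0 ?lact0 ?addr0 // liebC memvN lidealP.
Qed.

(** By Cartan's criterion the action of J would be nilpotent: the iterates of
    ad x on p.2 are brackets [x, w] with w in J. *)
Lemma not_trace_orthogonal_brackets :
  ~ forall x, x \in (J : {vspace L}) -> exists s : seq (L * L),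
     (forall p, p \in s -> p.2 \in (J : {vspace L}) /\
        forall w, w \in (J : {vspace L}) -> trform S p.1 (lieb x w) = 0) /\
     x - \sum_(p <- s) lieb p.1 p.2 \in (I : {vspace L}).
Proof.
move=> H; apply: not_all_nilpotent => x xJ; have [s [sJ sx]] := H x xJ.
apply: (@cartan_nilpotent _ _ _ [seq (rep S p.1, rep S p.2) | p <- s]) => //.
  have /eqP : rep S (x - \sum_(p <- s) lieb p.1 p.2) = 0.
    by apply/rep_eq0 => m; apply: I_triv.
  rewrite raddfB subr_eq0 => /eqP ->; rewrite raddf_sum big_map.
  by apply: eq_bigr => p _; rewrite /= rep_lieb.
move=> _ k /mapP[p /sJ[pJ p0] ->] /=.
rewrite -rep_iter_lieb -rep_lieb; apply: p0.
by elim: k => //= k IHk; apply: lidealP.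
Qed.

Variable f : 'Hom(L, S).
Hypotheses (cocycle_f : f \in cocycles1 S)
  (fI : forall x, x \in (I : {vspace L}) -> f x = 0).

(** An element z of J that acts nontrivially gives an L-endomorphism of S, and
    for [z, x] in I the cocycle identity reads z (f x) = x (f z). *)
Lemma coboundary_central :
    (forall x y, y \in (J : {vspace L}) -> lieb x y \in (I : {vspace L})) ->
  f \in coboundaries1 S.
Proof.
move=> cent.
have [z [m0 [zJ zm0]]] : exists z m0, z \in (J : {vspace L}) /\ lact z m0 <> 0 :> S.
  apply: contrapT => H; apply: J_nontriv => x m xJ; apply: contrapT => xm.
  by apply: H; exists x, m.
have Ez m : linfun (fun m : S => lact z m) m = lact z m.
  by apply: linfunE; apply: lact_linr.
apply: (coboundary_of_schur irrS (h := linfun (fun m : S => lact z m)) (m := f z)).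
- move=> x m; rewrite !Ez; apply/eqP; rewrite -subr_eq0 -lact_lieb liebC.
  by rewrite lactN1 I_triv ?oppr0 // cent.
- by apply/eqP => /lfunP/(_ m0); rewrite Ez zero_lfunE.
- move=> x; rewrite Ez; move/cocycles1P: cocycle_f => /(_ z x).
  rewrite liebC linearN /= (fI (cent _ _ zJ)) oppr0 => /esym/eqP.
  by rewrite subr_eq0 => /eqP.
Qed.

(** The trace form is nondegenerate on a complement of I in J; e is a basis of
    this complement, and e' is obtained from it by the inverse Gram matrix. *)
Lemma dual_bases :
    (forall x, x \in (J : {vspace L}) ->
      (forall y, y \in (J : {vspace L}) -> trform S x y = 0) ->
      x \in (I : {vspace L})) ->
  exists (r : nat) (e e' : 'I_r -> L),
   [/\ (0 < r)%N, forall i, e i \in (J : {vspace L}) /\ e' i \in (J : {vspace L}),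
     forall i j, trform S (e i) (e' j) = (i == j)%:R,
     forall w, w \in (J : {vspace L}) ->
       w - \sum_i trform S (e' i) w *: e i \in (I : {vspace L}) &
     forall w, w \in (J : {vspace L}) ->
       w - \sum_i trform S (e i) w *: e' i \in (I : {vspace L})].
Proof.
move=> nondeg.
have triI x y : y \in (I : {vspace L}) -> trform S x y = 0.
  move=> yI; rewrite /trform (_ : rep S y = 0) ?mulmx0 ?mxtrace0 //.
  by apply/rep_eq0 => m; apply: I_triv.
pose U := (J :\: I)%VS; pose r := \dim U.
pose e (i : 'I_r) : L := (vbasis U)`_i.
have UJ : (U <= J)%VS by apply: diffvSl.
have eU i : e i \in U by apply: vbasis_mem; apply: mem_nth; rewrite size_tuple.
have eJ i : e i \in (J : {vspace L}) := subvP UJ _ (eU i).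
have Jdec y : y \in (J : {vspace L}) -> exists c : 'I_r -> F,
    y - \sum_i c i *: e i \in (I : {vspace L}).
  rewrite -{1}(addv_diff_cap J I) => /memv_addP[u uU [i]].
  rewrite memv_cap => /andP[_ iI] ->; exists (fun k => coord (vbasis U) k u).
  by rewrite {1}(coord_vbasis uU) addrAC subrr add0r.
have perp w : w \in (J : {vspace L}) -> (forall k, trform S w (e k) = 0) ->
    w \in (I : {vspace L}).
  move=> wJ we; apply: nondeg => // y /Jdec[c /(triI w)/eqP].
  rewrite trformB subr_eq0 => /eqP ->; rewrite trform_sumr big1 // => i _.
  by rewrite we mulr0.
pose G := \matrix_(i, j) trform S (e i) (e j).
have Gunit : G \in unitmx.
  rewrite -row_free_unit -kermx_eq0; apply/eqP/row_matrixP => k; rewrite row0.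
  set v := row k _; have vG : v *m G = 0 by rewrite /v -row_mul mulmx_ker row0.
  pose w := \sum_i v 0 i *: e i.
  have wU : w \in U by rewrite memv_suml // => i _; apply: memvZ.
  have wI : w \in (I : {vspace L}).
    apply: perp (subvP UJ _ wU) _ => j; rewrite trformC trform_sumr.
    transitivity ((v *m G) 0 j); last by rewrite vG mxE.
    by rewrite [RHS]mxE; apply: eq_bigr => i _; rewrite [G _ _]mxE trformC.
  have w0 : w = 0.
    have : w \in (U :&: I)%VS by rewrite memv_cap wU.
    by rewrite capv_diff memv0 => /eqP.
  apply/matrixP => a i; rewrite ord1 [RHS]mxE.
  have := congr1 (coord (vbasis U) i) w0.
  by rewrite linear0 coord_sum_free ?(basis_free (vbasisP U)).
pose e' (i : 'I_r) := \sum_j invmx G i j *: e j.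
have e'J i : e' i \in (J : {vspace L}).
  by rewrite memv_suml // => j _; apply: memvZ.
have dual i j : trform S (e i) (e' j) = (i == j)%:R.
  rewrite trformC.
  transitivity ((invmx G *m G) j i); last by rewrite mulVmx // mxE eq_sym.
  rewrite trformC /e' trform_sumr mxE; apply: eq_bigr => k _.
  by rewrite mxE trformC.
have e_e' k : e k = \sum_j G k j *: e' j.
  under eq_bigr do rewrite /e' scaler_sumr.
  rewrite exchange_big /=.
  transitivity (\sum_i (G *m invmx G) k i *: e i).
    rewrite mulmxV // (bigD1 k) //= big1 => [|i ik].
      by rewrite mxE eqxx scale1r addr0.
    by rewrite mxE eq_sym (negPf ik) scale0r.
  apply: eq_bigr => i _; rewrite mxE scaler_suml.
  by apply: eq_bigr => j _; rewrite scalerA.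
exists r, e, e'; split=> //.
- rewrite lt0n; apply/negP => /eqP r0; apply: chief_factor_proper.
  apply/subvP => w wJ; apply: perp => // k; by have := ltn_ord k; rewrite {2}r0.
- move=> w wJ; apply: perp => [|k].
    by rewrite memvB // memv_suml // => i _; apply: memvZ.
  rewrite e_e' trform_sumr big1 // => j _.
  rewrite trformC trformB trform_sumr (bigD1 j) //= big1 => [|i ij].
    by rewrite [trform S (e' j) (e j)]trformC dual eqxx mulr1 addr0 subrr mulr0.
  by rewrite [trform S (e' j) (e i)]trformC dual (negPf ij) mulr0.
- move=> w wJ; apply: perp => [|k].
    by rewrite memvB // memv_suml // => i _; apply: memvZ.
  rewrite trformC trformB trform_sumr (bigD1 k) //= big1 => [|i ik].
    by rewrite dual eqxx mulr1 addr0 subrr.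
  by rewrite dual eq_sym (negPf ik) mulr0.
Qed.

(** Let C be the sum of the e_i e'_i, and T f the sum of the e_i (f e'_i).
    Invariance of the trace form cancels the brackets in x (T f), which leaves
    x (T f) = C (f x).  For the coboundary of m this says that C commutes with
    L; its trace is dim (J / I), which is nonzero in characteristic zero, so
    Schur's lemma applies to C. *)
Lemma coboundary_casimir :
    (forall x, x \in (J : {vspace L}) ->
      (forall y, y \in (J : {vspace L}) -> trform S x y = 0) ->
      x \in (I : {vspace L})) ->
  f \in coboundaries1 S.
Proof.
move=> /dual_bases[r [e [e' [r_gt0 eJ dual exp_e exp_e']]]].
pose T (g : 'Hom(L, S)) : S := \sum_i lact (e i) (g (e' i)).
pose C (m : S) : S := \sum_i lact (e i) (lact (e' i) m).
have T_casimir (g : 'Hom(L, S)) x : g \in cocycles1 S ->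
    (forall x, x \in (I : {vspace L}) -> g x = 0) -> lact x (T g) = C (g x).
  move=> /cocycles1P gcoc gI.
  have e_eq i : lact (lieb x (e i)) (g (e' i)) =
      \sum_k trform S (e' k) (lieb x (e i)) *: lact (e k) (g (e' i)).
    have xJ : lieb x (e i) \in (J : {vspace L}) by apply: lidealP; case: (eJ i).
    have /(I_triv (g (e' i))) := exp_e _ xJ.
    rewrite lactD1 lactN1 lact_suml => /eqP; rewrite subr_eq0 => /eqP ->.
    by apply: eq_bigr => k _; rewrite lactZ1.
  have e'_eq i : g (lieb x (e' i)) =
      \sum_k trform S (e k) (lieb x (e' i)) *: g (e' k).
    have xJ : lieb x (e' i) \in (J : {vspace L}) by apply: lidealP; case: (eJ i).
    have /gI/eqP := exp_e' _ xJ; rewrite linearB subr_eq0 => /eqP ->.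
    by rewrite linear_sum; apply: eq_bigr => k _; rewrite linearZ.
  have -> : lact x (T g) = C (g x) + \sum_i (lact (lieb x (e i)) (g (e' i)) +
       lact (e i) (g (lieb x (e' i)))).
    rewrite /T /C lact_sumr -big_split /=; apply: eq_bigr => i _.
    rewrite lact_lieb gcoc (lactD2 (e i)) lactN2.
    by rewrite (addrA (_ - _)) subrK addrC subrK.
  rewrite big_split /= (eq_bigr _ (fun i _ => e_eq i)).
  under [X in _ + (_ + X)]eq_bigr do rewrite e'_eq lact_sumr.
  rewrite [X in _ + (_ + X)]exchange_big /= -big_split /= big1 ?addr0 // => i _.
  rewrite -big_split /= big1 // => k _.
  rewrite lactZ2 -scalerDl [trform S (e i) _]trformC trform_lieb.
  by rewrite addrN scale0r.
have C_lin : linear C.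
  move=> a u v; rewrite /C scaler_sumr -big_split /=; apply: eq_bigr => i _.
  by rewrite !lactD2 !lactZ2.
have EC : linfun C =1 C by apply: linfunE.
apply: (coboundary_of_schur irrS (h := linfun C) (m := T f)).
- move=> x m; rewrite !EC.
  have bm : ce_d0 S m \in cocycles1 S.
    by apply: (subvP (coboundaries1_sub S)); apply: memv_img; apply: memvf.
  have := T_casimir _ x bm; rewrite ce_d0E => <- => [|y yI]; last first.
    by rewrite ce_d0E I_triv.
  by rewrite /T /C; congr (lact x _); apply: eq_bigr => i _; rewrite ce_d0E.
- apply/eqP => C0; have /(congr1 mxtrace) : \sum_i rep S (e i) *m rep S (e' i) = 0.
    apply: colv_eq => m; rewrite mul0mx mulmx_suml.
    transitivity (colv (C m)); last by rewrite -EC C0 zero_lfunE linear0.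
    by rewrite linear_sum; apply: eq_bigr => i _; rewrite -mulmxA !rep_colv.
  rewrite linear_sum mxtrace0 /=.
  under eq_bigr => i _ do rewrite -[\tr _]/(trform S (e i) (e' i)) dual eqxx.
  rewrite sumr_const card_ord => /eqP.
  by rewrite (iffLR (pcharf0P F)) // -leqn0 leqNgt r_gt0.
- by move=> x; rewrite EC; apply/esym/T_casimir.
Qed.

(** What remains is to feed not_trace_orthogonal_brackets in two ways.  If J / I is
    abelian but not central, each element x of J is a sum of brackets [u, v]
    modulo I, and [x, w] acts by zero for w in J.  If J / I is perfect and the
    trace form vanishes on J, then u can be taken in J, where u is orthogonal
    to [x, w]. *)
Lemma coboundary_of_vanishing : f \in coboundaries1 S.
Proof.
have fullP (x y : L) : y \in (fullv : {vspace L}) -> lieb x y \in (fullv : {vspace L}).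
  by move=> _; apply: memvf.
have [JJI|JJ] := bracket_sum_dichotomy J.
  have [LJI|LJ] := bracket_sum_dichotomy (LieIdeal fullP).
    by apply: coboundary_central => x y; apply: LJI; apply: memvf.
  case: not_trace_orthogonal_brackets => x xJ; have [s [sJ sx]] := LJ x xJ.
  exists s; split=> // p /sJ[_ pJ]; split=> // w wJ.
  rewrite /trform (_ : rep S (lieb x w) = 0) ?mulmx0 ?mxtrace0 //.
  by apply/rep_eq0 => m; apply: I_triv; apply: JJI.
have [||||| nondeg | deg] := chief_factor_dichotomy (P := fun x =>
    x \in (J : {vspace L}) /\ forall y, y \in (J : {vspace L}) -> trform S x y = 0).
- by split=> [|y _]; rewrite ?mem0v // /trform linear0 mul0mx mxtrace0.
- move=> a x y [xJ x0] [yJ y0]; split=> [|z zJ]; first by rewrite memvD ?memvZ.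
  have := x0 z zJ; have := y0 z zJ.
  rewrite /trform linearP mulmxDl -scalemxAl mxtraceD mxtraceZ => -> ->.
  by rewrite mulr0 addr0.
- move=> z x [xJ x0]; split=> [|y yJ]; first exact: lidealP.
  by rewrite trform_lieb x0 ?oppr0 // lidealP.
- move=> x xI; split=> [|y yJ]; first exact: (subvP IJ).
  rewrite /trform (_ : rep S x = 0) ?mul0mx ?mxtrace0 //.
  by apply/rep_eq0 => m; apply: I_triv.
- by move=> x [].
- by apply: coboundary_casimir => x xJ x0; apply: nondeg.
- case: not_trace_orthogonal_brackets => x xJ; have [s [sJ sx]] := JJ x xJ.
  exists s; split=> // p /sJ[pJ pJ']; split=> // w wJ.
  by apply: (deg _ pJ).2; apply: lidealP.
Qed.

End ChiefFactor.

(** * Relative cocycles and split factors *)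

Section RelativeCocycles.
Variables (F : fieldType) (L : lieAlgType F) (S : lieModType L).

(** Restriction to K, followed by extension by zero on the chosen complement of
    K, so that it stays an endomorphism of 'Hom(L, S). *)
Definition restr (K : {vspace L}) : 'Hom('Hom(L, S), 'Hom(L, S)) :=
  linfun (fun f : 'Hom(L, S) => (f \o projv K)%VF).

Lemma restrE K f : restr K f = (f \o projv K)%VF.
Proof.
by apply: linfunE => a u v; rewrite comp_lfunDl -comp_lfunZl.
Qed.

Definition rel_cocycles (K : {vspace L}) : {vspace 'Hom(L, S)} :=
  (cocycles1 S :&: lker (restr K))%VS.

Lemma restr_eq0 K f : restr K f = 0 <-> forall x, x \in K -> f x = 0.
Proof.
rewrite restrE; split=> [/lfunP f0 x xK|f0].
  by have := f0 x; rewrite comp_lfunE projv_id // zero_lfunE.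
by apply/lfunP => x; rewrite comp_lfunE zero_lfunE f0 ?memv_proj.
Qed.

Lemma restr_eq (K : {vspace L}) (f g : 'Hom(L, S)) :
  (forall x, x \in K -> f x = g x) -> restr K f = restr K g.
Proof.
move=> fg; rewrite !restrE; apply/lfunP => x.
by rewrite !comp_lfunE fg ?memv_proj.
Qed.

Lemma rel_cocyclesP K f : f \in rel_cocycles K <->
  f \in cocycles1 S /\ forall x, x \in K -> f x = 0.
Proof.
rewrite memv_cap [X in _ && X]memv_ker; split=> [/andP[fc /eqP f0]|[fc f0]].
  by split=> //; apply: (iffLR (restr_eq0 K f)).
by rewrite fc; apply/eqP/restr_eq0.
Qed.

(** For x in I the cocycle identity gives x (f y) = f [x, y] = 0, and the
    vectors killed by I form a submodule. *)
Lemma acts_trivially_of_rel_cocycle (I : lieIdeal L) f : irreducible_lmod S ->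
  f \in rel_cocycles I -> f != 0 -> acts_trivially S I.
Proof.
move=> irrS /rel_cocyclesP[/cocycles1P fc fI] f0.
suff H : forall m : S, forall x, x \in (I : {vspace L}) -> lact x m = 0.
  by move=> x m xI; apply: H.
apply: (irreducible_pred irrS).
- by move=> x _; rewrite lact0.
- by move=> a u v u0 v0 x xI; rewrite lactD2 lactZ2 u0 // v0 // scaler0 addr0.
- move=> z v v0 y yI.
  have -> : lact y (lact z v) = lact (lieb y z) v + lact z (lact y v).
    by rewrite lact_lieb subrK.
  by rewrite v0 ?v0 ?lact0 ?addr0 // liebC memvN lidealP.
apply: contrapT => H; move/negP: f0; apply; apply/eqP/lfunP => y.
rewrite zero_lfunE; apply: contrapT => fy; apply: H; exists (f y); first exact/eqP.
move=> x xI; have := fc x y; rewrite (fI x) // lact0 subr0 => <-.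
by apply: fI; rewrite liebC memvN lidealP.
Qed.

End RelativeCocycles.

Section SplitFactor.
Variables (F : fieldType) (L : lieAlgType F) (S : lieModType L).
Variables (I J : lieIdeal L).
Hypothesis IJ : (I <= J)%VS.

(** Cocycles that induce an isomorphism of J / I onto S. *)
Definition splitting_cocycle (p : 'Hom(L, S)) :=
  [/\ p \in rel_cocycles S I,
      forall x, x \in (J : {vspace L}) -> p x = 0 -> x \in (I : {vspace L}) &
      forall m, exists2 x, x \in (J : {vspace L}) & p x = m].

Lemma lquot0 (K : lieIdeal L) x : lquot K x = 0 <-> x \in (K : {vspace L}).
Proof. by rewrite -[in X in _ <-> X](lker_lquot K) memv_ker; split=> [->|/eqP]. Qed.

Lemma vsval_lfactorP (u : lieFactor I J) :
  exists2 x, x \in (J : {vspace L}) & vsval u = lquot I x.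
Proof. by have /memv_imgP := subvsP u. Qed.

Section OfCocycle.
Variable p : 'Hom(L, S).
Hypotheses (J_triv : acts_trivially S J) (p_split : splitting_cocycle p).

Let p_coc : forall x y, p (lieb x y) = lact x (p y) - lact y (p x).
Proof. by case: p_split => /rel_cocyclesP[/cocycles1P]. Qed.

Let p_I : forall x, x \in (I : {vspace L}) -> p x = 0.
Proof. by case: p_split => /rel_cocyclesP[]. Qed.

Let p_J : forall x, x \in (J : {vspace L}) -> p x = 0 -> x \in (I : {vspace L}).
Proof. by case: p_split. Qed.

Let p_vsval x : p (vsval (lquot I x)) = p x.
Proof. by rewrite vsval_lquot linearB /= (p_I (memv_proj I x)) subr0. Qed.

Lemma abelian_of_cocycle : abelian_lideal (lquot_img I J).
Proof.
move=> _ _ /memv_imgP[x xJ ->] /memv_imgP[y yJ ->]; rewrite -lquot_lie_hom.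
by apply/lquot0/p_J; rewrite ?lidealP // p_coc !J_triv ?subr0.
Qed.

Lemma isog_of_cocycle : lmod_isog (lieFactor I J) S.
Proof.
pose f0 (u : lieFactor I J) : S := p (vsval (vsval u)).
have f0_lin : linear f0 by move=> a u v; rewrite /f0 lfactor_valP lquot_valP lhomP.
have Ef := linfunE f0_lin; exists (linfun f0); split=> [x m|].
  rewrite !Ef /f0 vsval_lfactor_act; have [y yJ ->] := vsval_lfactorP m.
  by rewrite -lquot_lie_hom !p_vsval p_coc (J_triv (p x) yJ) subr0.
have ker0 : lker (linfun f0) == 0%VS.
  rewrite -subv0; apply/subvP => u; rewrite memv_ker Ef /f0 memv0 => /eqP.
  have [x xJ ux] := vsval_lfactorP u; rewrite ux p_vsval => /(p_J xJ)/lquot0 x0.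
  apply/eqP/lfactor_val_inj; rewrite ux x0.
  exact/esym/(linear0 (@vsval _ _ (lquot_img I J))).
exists (linfun f0)^-1%VF; first exact: lker0_lfunK.
move=> m; apply: limg_lfunVK; case: p_split => _ _ /(_ m)[x xJ <-].
have ux : lquot I x \in (lquot_img I J : {vspace _}) by apply: memv_img.
apply/memv_imgP; exists (vsproj (lquot_img I J) (lquot I x)); rewrite ?memvf //.
by rewrite Ef /f0 vsprojK // p_vsval.
Qed.

(** The zeros of p form a subalgebra, since p [x, y] = x (p y) - y (p x), and
    this subalgebra meets each coset of J in exactly one coset of I.  The map c
    moves x inside its coset of J to a zero of p, linearly. *)
Lemma splits_of_cocycle : lie_ext_splits I J.
Proof.
pose pJ := (p \o projv J)%VF.
have pJ_sur m : pJ (pJ^-1%VF m) = m.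
  apply: limg_lfunVK; case: p_split => _ _ /(_ m)[x xJ <-].
  by apply/memv_imgP; exists x; rewrite ?memvf // comp_lfunE projv_id.
pose sg m := projv J (pJ^-1%VF m).
have sgJ m : sg m \in (J : {vspace L}) by apply: memv_proj.
have p_sg m : p (sg m) = m by rewrite -[RHS]pJ_sur comp_lfunE.
pose c x := x - sg (p x).
have c_lin : linear c.
  move=> a x y; rewrite /c /sg !lhomP.
  by rewrite scalerBr opprD addrACA.
have pc x : p (c x) = 0 by rewrite linearB /= p_sg subrr.
have uniq x y : p x = 0 -> p y = 0 -> lquot J x = lquot J y -> lquot I x = lquot I y.
  move=> px py /lquot_eq xyJ; apply/lquot_eq/p_J => //.
  by rewrite linearB /= px py subrr.
have lqc x : lquot J (c x) = lquot J x.
  by apply/lquot_eq; rewrite /c addrAC subrr add0r memvN.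
pose s0 (u : lieQuot J) := lquot I (c (vsval u)).
have s_lin : linear s0.
  by move=> a u v; rewrite /s0 lquot_valP c_lin lhomP.
have Es := linfunE s_lin; exists (linfun s0); split=> [u v|u].
  rewrite !Es /s0 -lquot_lie_hom; apply: uniq => //.
    by rewrite p_coc !pc !lact0 subrr.
  by rewrite lqc lquotK lquot_lie_hom !lqc !lquotK.
by rewrite Es /s0 lquot_mapE // lqc lquotK.
Qed.

End OfCocycle.

(** The cocycle is the projection of L onto J / I along the image of the
    section s, followed by the isomorphism phi; the cocycle identity uses that
    J / I is abelian. *)
Lemma splitting_cocycle_of_split : split_factor S I J ->
  acts_trivially S J /\ exists p, splitting_cocycle p.
Proof.
move=> [abel [phi [phiL [phi' phiK phi'K]]] [s [s_hom sK]]]; split.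
  move=> x m xJ; rewrite -(phi'K m) -phiL.
  rewrite (_ : lact x (phi' m) = 0) ?linear0 //; apply: lfactor_val_inj.
  rewrite vsval_lfactor_act abel ?memv_img //.
  exact: subvsP.
pose pi x := lquot I x - s (lquot J x).
have piA x : pi x \in (lquot_img I J : {vspace _}).
  have : lquot_map I J (pi x) = 0 by rewrite linearB /= lquot_mapE // sK subrr.
  rewrite -(lquotK (pi x)) lquot_mapE // => /lquot0; exact: memv_img.
have pi_lin : linear pi.
  by move=> a x y; rewrite /pi !lhomP scalerBr opprD addrACA.
have pi_coc x y : pi (lieb x y) = lieb (lquot I x) (pi y) - lieb (lquot I y) (pi x).
  have Dx z : lquot I z = pi z + s (lquot J z) by rewrite /pi subrK.
  rewrite {1}/pi !lquot_lie_hom s_hom !Dx.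
  move: (pi x) (pi y) (piA x) (piA y) => u v uA vA.
  rewrite !liebD1 !liebD2 (abel u v) // (abel v u) // !add0r addrA addrK.
  by rewrite [in RHS](liebC _ u) opprK addrC.
pose p0 x : S := phi (vsproj (lquot_img I J) (pi x) : lieFactor I J).
have p_lin : linear p0 by move=> a x y; rewrite /p0 pi_lin !linearP.
have Ep := linfunE p_lin.
have vsprojI (x : L) : x \in (J : {vspace L}) -> pi x = lquot I x.
  by move=> /lquot0 xJ; rewrite /pi xJ linear0 subr0.
exists (linfun p0); split.
- apply/rel_cocyclesP; split=> [|x xI].
    apply/cocycles1P => x y; rewrite !Ep /p0 pi_coc.
    have act z w : vsproj (lquot_img I J) (lieb (lquot I z) (pi w)) =
        lact z (vsproj (lquot_img I J) (pi w) : lieFactor I J).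
      by apply: lfactor_val_inj; rewrite vsval_lfactor_act !vsprojK // lidealP.
    by rewrite linearB /= !act linearB /= !phiL.
  rewrite Ep /p0 vsprojI ?(subvP IJ) //.
  by rewrite (iffRL (lquot0 I x) xI) !linear0.
- move=> x xJ; rewrite Ep /p0 vsprojI // => /(congr1 phi').
  rewrite phiK -(linear0 phi) phiK => x0; apply/lquot0.
  rewrite -(vsprojK (memv_img (lquot I) xJ)) x0.
  exact: (linear0 (@vsval _ _ (lquot_img I J))).
- move=> m; have [x xJ ux] := vsval_lfactorP (phi' m); exists x => //.
  rewrite Ep /p0 vsprojI // -[RHS]phi'K; congr (phi _); apply: lfactor_val_inj.
  by rewrite vsprojK ?ux // memv_img.
Qed.

Lemma split_factorP : split_factor S I J <->
  acts_trivially S J /\ exists p, splitting_cocycle p.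
Proof.
split; first exact: splitting_cocycle_of_split.
move=> [J_triv [p p_split]]; split.
- exact: abelian_of_cocycle p_split.
- exact: isog_of_cocycle p_split.
- exact: splits_of_cocycle p_split.
Qed.

End SplitFactor.

(** * The dimension count along a chief series *)

Section Step.
Variables (F : fieldType) (L : lieAlgType F) (S : lieModType L).
Variables (I J : lieIdeal L).
Hypotheses (IJ : (I <= J)%VS) (minIJ : minimal_lideal (lquot_img I J))
  (irrS : irreducible_lmod S).

(** When J acts trivially, the restriction of f to J is L-equivariant: its
    kernel contains I and is not J, so that it is I, and its image is a nonzero
    submodule of S. *)
Lemma splitting_cocycle_of_nonzero (f : 'Hom(L, S)) :
    acts_trivially S J -> f \in rel_cocycles S I -> restr S J f != 0 ->
  splitting_cocycle I J f.
Proof.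
move=> J_triv fZ fJ; have /rel_cocyclesP[/cocycles1P fc fI] := fZ.
have fLJ x y : y \in (J : {vspace L}) -> f (lieb x y) = lact x (f y).
  by move=> yJ; rewrite fc (J_triv y) // subr0.
split=> //.
  have [||||| sub | all] := chief_factor_dichotomy minIJ
    (P := fun x => x \in (J : {vspace L}) /\ f x = 0).
  - by rewrite mem0v linear0.
  - move=> a x y [xJ fx] [yJ fy]; rewrite memvD ?memvZ //.
    by rewrite lhomP fx fy scaler0 addr0.
  - by move=> x y [yJ fy]; rewrite lidealP // fLJ // fy lact0.
  - by move=> x xI; rewrite fI // (subvP IJ).
  - by move=> x [].
  - by move=> x xJ fx; apply: sub.
  - by case/eqP: fJ; apply/restr_eq0 => x /all[].
apply: (irreducible_pred irrS).
- by exists 0; rewrite ?mem0v ?linear0.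
- move=> a _ _ [x xJ <-] [y yJ <-].
  by exists (a *: x + y); rewrite ?lhomP // memvD ?memvZ.
- move=> x _ [y yJ <-]; exists (lieb x y); [exact: lidealP|exact: fLJ].
apply: contrapT => H; case/eqP: fJ; apply/restr_eq0 => x xJ.
by apply: contrapT => fx; apply: H; exists (f x); [apply/eqP|exists x].
Qed.

Lemma rel_cocyclesS : (rel_cocycles S J <= rel_cocycles S I)%VS.
Proof.
apply/subvP => f /rel_cocyclesP[fc fJ]; apply/rel_cocyclesP; split=> // x xI.
by apply: fJ; apply: (subvP IJ).
Qed.

Lemma rel_cocycles_ker_restr :
  (rel_cocycles S I :&: lker (restr S J))%VS = rel_cocycles S J.
Proof.
apply/vspaceP => f; rewrite memv_cap [X in _ && X]memv_ker.
apply/andP/idP => [[fI /eqP/restr_eq0 fJ]|fJ].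
  by apply/rel_cocyclesP; split=> //; case/rel_cocyclesP: fI.
by split; [apply: (subvP rel_cocyclesS)|apply/eqP/restr_eq0; case/rel_cocyclesP: fJ].
Qed.

(** A cocycle of Z(I) and p differ on J by the endomorphism h of S that sends
    p x to f x, and conversely h \o p is again a cocycle. *)
Lemma restr_splitting_cocycle (p : 'Hom(L, S)) :
    acts_trivially S J -> splitting_cocycle I J p ->
  \dim (restr S J @: rel_cocycles S I) = \dim (lmod_end S).
Proof.
move=> J_triv [pZ p_J p_sur]; have /rel_cocyclesP[/cocycles1P pc pI] := pZ.
pose g : 'Hom('End(S), 'Hom(L, S)) := linfun (fun h : 'End(S) => restr S J (h \o p)%VF).
have Eg h : g h = restr S J (h \o p)%VF.
  by apply: linfunE => a u v; rewrite comp_lfunDl -comp_lfunZl linearP.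
have hpZ h : h \in lmod_end S -> (h \o p)%VF \in rel_cocycles S I.
  move=> /mem_lmod_end hL; apply/rel_cocyclesP; split=> [|x xI].
    by apply/cocycles1P => x y; rewrite !comp_lfunE pc linearB /= !hL.
  by rewrite comp_lfunE pI ?linear0.
rewrite -(@limg_dim_eq _ _ _ g (lmod_end S)).
  congr (\dim _); apply/eqP; rewrite eqEsubv; apply/andP; split; last first.
    apply/subvP => _ /memv_imgP[h hE ->]; rewrite Eg memv_img //; exact: hpZ.
  apply/subvP => _ /memv_imgP[f fZ ->].
  have /rel_cocyclesP[/cocycles1P fc fI] := fZ.
  have sur m : exists x, x \in (J : {vspace L}) /\ p x = m.
    by have [x xJ px] := p_sur m; exists x.
  have [sec Hsec] := choice sur.
  have fp x y : x \in (J : {vspace L}) -> y \in (J : {vspace L}) ->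
      p x = p y -> f x = f y.
    move=> xJ yJ pxy; apply/eqP; rewrite -subr_eq0 -linearB; apply/eqP/fI/p_J.
      exact: memvB.
    by rewrite linearB /= pxy subrr.
  pose h0 m := f (sec m).
  have secJ m : sec m \in (J : {vspace L}) := (Hsec m).1.
  have psec m : p (sec m) = m := (Hsec m).2.
  have h0_lin : linear h0.
    move=> a u v; rewrite /h0 -lhomP; apply: fp; rewrite ?memvD ?memvZ //.
    by rewrite lhomP !psec.
  have Eh := linfunE h0_lin.
  have hL : linfun h0 \in lmod_end S.
    apply/mem_lmod_end => x m; rewrite !Eh /h0.
    have -> : lact x (f (sec m)) = f (lieb x (sec m)).
      by rewrite fc (J_triv (sec m)) // subr0.
    by apply: fp; rewrite ?lidealP // psec pc psec (J_triv (sec m)) // subr0.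
  apply/memv_imgP; exists (linfun h0) => //; rewrite Eg; apply: restr_eq => x xJ.
  by rewrite comp_lfunE Eh /h0; apply: fp.
apply/eqP; rewrite -subv0; apply/subvP => h; rewrite memv_cap memv0 => /andP[_].
rewrite memv_ker Eg => /eqP/restr_eq0 h0; apply/eqP/lfunP => m.
have [x xJ <-] := p_sur m.
by have := h0 x xJ; rewrite comp_lfunE zero_lfunE.
Qed.

Hypothesis charF0 : [pchar F] =i pred0.

(** Adding the coboundaries makes the count uniform: as soon as J acts
    nontrivially, Z(I) and Z(J) are both absorbed by them. *)
Lemma dim_rel_cocycles_step :
  \dim (rel_cocycles S I + coboundaries1 S) =
  (\dim (rel_cocycles S J + coboundaries1 S) +
   \dim (lmod_end S) * `[< split_factor S I J >])%N.
Proof.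
have [J_triv | J_nontriv] := pselect (acts_trivially S J); last first.
  rewrite (_ : `[< split_factor S I J >] = false) ?muln0 ?addn0; last first.
    by apply/asboolPn => /(split_factorP S IJ)[].
  have ZB : (rel_cocycles S I <= coboundaries1 S)%VS.
    apply/subvP => f fZ; have [->|f0] := eqVneq f 0; first exact: mem0v.
    have I_triv := acts_trivially_of_rel_cocycle irrS fZ f0.
    have /rel_cocyclesP[fc fI] := fZ.
    by apply: (coboundary_of_vanishing (I := I) (J := J)).
  by rewrite (elimT addv_idPr ZB) (elimT addv_idPr (subv_trans rel_cocyclesS ZB)).
have BZ : (coboundaries1 S <= rel_cocycles S J)%VS.
  apply/subvP => f fB; apply/rel_cocyclesP.
  split; first exact: (subvP (coboundaries1_sub S)).
  by move: fB => /coboundaries1P[m fm] x xJ; rewrite fm J_triv.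
rewrite (elimT addv_idPl BZ) (elimT addv_idPl (subv_trans BZ rel_cocyclesS)).
rewrite -(limg_ker_dim (restr S J) (rel_cocycles S I)) rel_cocycles_ker_restr.
congr (_ + _)%N; case: asboolP => [|nsplit].
  move=> /(split_factorP S IJ)[_ [p /(restr_splitting_cocycle J_triv) ->]].
  by rewrite muln1.
rewrite muln0; apply/eqP; rewrite dimv_eq0 -subv0; apply/subvP => _ /memv_imgP[f fZ ->].
rewrite memv0; apply/negPn/negP => fJ; apply: nsplit; apply/split_factorP => //.
by split=> //; exists f; apply: splitting_cocycle_of_nonzero.
Qed.

End Step.

Theorem theorem3p3 (F : fieldType) (charF0 : [pchar F] =i pred0)
  (L : lieAlgType F) (n : nat) (c : nat -> lieIdeal L)
  (chief_c : chief_series n c)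
  (S : lieModType L) (irrS : irreducible_lmod S) :
  dimH1 S = (\dim (lmod_end S) * split_mult n c S)%N.
Proof.
have [c0 cn c_step] := chief_c.
have Z0 : rel_cocycles S (c 0%N) = cocycles1 S.
  apply/vspaceP => f; apply/idP/idP => [/rel_cocyclesP[]//|fc].
  by apply/rel_cocyclesP; split=> // x; rewrite c0 memv0 => /eqP ->; rewrite linear0.
have Zn : rel_cocycles S (c n) = 0%VS.
  apply/eqP; rewrite -subv0; apply/subvP => f /rel_cocyclesP[_ f0].
  by rewrite memv0; apply/eqP/lfunP => x; rewrite f0 ?zero_lfunE // cn memvf.
have telescope m : (m <= n)%N -> \dim (cocycles1 S) =
    (\dim (rel_cocycles S (c m) + coboundaries1 S) +
     \dim (lmod_end S) * \sum_(j < m) `[< split_factor S (c j) (c j.+1) >])%N.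
  elim: m => [_|m IHm lt_mn].
    by rewrite big_ord0 muln0 addn0 Z0 (elimT addv_idPl (coboundaries1_sub S)).
  have [cS cmin] := c_step m lt_mn.
  rewrite (IHm (ltnW lt_mn)) (dim_rel_cocycles_step cS cmin irrS charF0).
  by rewrite big_ord_recr mulnDr /= -addnA [X in (_ + X)%N]addnC.
rewrite /dimH1 (telescope n (leqnn n)) Zn add0v addKn.
by rewrite /split_mult -sum1dep_card [in RHS]big_mkcond.
Qed.
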